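(* Let $0<\varepsilon\le 1$. Let $E\subset\mathbb{R}^n$ be a Borel set such that $$\dim_H E>\left\lfloor\left(1-\frac{\varepsilon^2}{8\log(8/\varepsilon)}\right)\cdot n\right\rfloor+1.$$ Then for every $\alpha\in[0,\pi]$, $E$ contains three distinct points $x,y,z$ such that $\angle xyz\in(\alpha-\pi\varepsilon,\alpha+\pi\varepsilon)$.
   Context: $\dim_H$ denotes Hausdorff dimension, $\log$ is the natural logarithm, $n$ is a positive integer, and $\angle xyz\in[0,\pi]$ is the angle at $y$ between the vectors $x-y$ and $z-y$. *)

(* Defs.v *)
From HB Require Import structures.
From mathcomp Require Import all_boot all_order all_algebra.
From mathcomp Require Import all_classical all_reals all_analysis.

Set Implicit Arguments.
Unset Strict Implicit.
Unset Printing Implicit Defensive.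

Import Order.TTheory GRing.Theory Num.Theory.
Import numFieldNormedType.Exports.

Local Open Scope classical_set_scope.
Local Open Scope ring_scope.

Section euclidean_space.
Context {R : realType} {n : nat}.
Implicit Types (x y z : 'rV[R]_n) (A U : set 'rV[R]_n).

Definition dotv x y : R := \sum_(i < n) x ord0 i * y ord0 i.

(* The norm that MathComp-Analysis puts on ['rV[R]_n] is the sup norm, so the
   Euclidean one is defined here; both induce the same topology. *)
Definition enorm x : R := Num.sqrt (dotv x x).

(* Meaningful when [x != y] and [z != y]; the argument of [acos] then lies in
   [[-1, 1]] by Cauchy-Schwarz. *)
Definition angle x y z : R :=
  acos (dotv (x - y) (z - y) / (enorm (x - y) * enorm (z - y))).

Definition borel_set A : Prop :=
  <<s [set U : set 'rV[R]_n | open U] >> A.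

Local Open Scope ereal_scope.

(* The point 0 is added so that the empty set has diameter 0, not -oo. *)
Definition diam U : \bar R :=
  ereal_sup (0 |` [set (enorm (p.1 - p.2))%:E | p in U `*` U]).

(* [diam U ^ s], with the conventions that at [s = 0] a nonempty set of
   diameter 0 contributes 1 and the empty set contributes 0. *)
Definition diam_pow (s : R) U : \bar R :=
  if U == set0 then 0 else poweR (diam U) s.

Definition hausdorff_premeasure (s delta : R) A : \bar R :=
  ereal_inf [set \sum_(0 <= i <oo) diam_pow s (U i) |
    U in [set U : (set 'rV[R]_n)^nat |
      A `<=` \bigcup_i U i /\ forall i, diam (U i) <= delta%:E]].

(* The limit as [delta] tends to [0+] is a supremum, since
   [hausdorff_premeasure s delta A] is nonincreasing in [delta]. *)
Definition hausdorff_measure (s : R) A : \bar R :=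
  ereal_sup [set hausdorff_premeasure s delta A |
    delta in [set delta : R | (0 < delta)%R]].

Definition hausdorff_dim A : \bar R :=
  ereal_inf [set s%:E |
    s in [set s : R | (0 <= s)%R /\ hausdorff_measure s A = 0]].

End euclidean_space.

(* Main.v *)
Require Import Defs.
From HB Require Import structures.
From mathcomp Require Import all_boot all_order all_algebra.
From mathcomp Require Import all_classical all_reals all_analysis.
From mathcomp Require Import ring lra zify.

Set Implicit Arguments.
Unset Strict Implicit.
Unset Printing Implicit Defensive.

Import Order.TTheory GRing.Theory Num.Theory.
Import numFieldNormedType.Exports.

Local Open Scope classical_set_scope.
Local Open Scope ring_scope.

(** Write [c] for the codimension [n - s], where [s] is the bound on the
    dimension, so that [c] is less than [eps ^+ 2 / (8 * ln (8 / eps)) * n].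

    Main case: [eps <= 1/3] and [alpha] at distance at least [pi * eps] from [0]
    and [pi].  Since [dim E > s], at some scale the number of grid positions
    within [M ^ k.+1] of [E] is at most [M ^ c] times the number within [M ^ k].
    By Cauchy-Schwarz there is a point [y] of [E] such that, for independent
    random displacements [u], [u'] in a box of side [L = (M - 1) * M ^ k], the
    difference [u - u'] comes from a point of [E], seen from [y], with
    probability at least [M ^- c].  The coordinates of [u] and [u'] have a
    strictly log-concave law, so a discrete Prekopa-Leindler inequality gives
    concentration of measure: two sets of pairs [(u, u')] of mass larger than
    [expR (- b)] contain elements at squared distance [O(b)].  It is applied to
    the good pairs and to their images under the exchange of [u i] and [u' i]
    for [i < j], where [j] is chosen, depending on the pair, such that the
    resulting sign changes turn [u - u'] by an angle close to [alpha].  This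
    yields two points of [E] seen from [y] under an angle close to [alpha].

    Angles close to [0] and to [pi] occur in every infinite set, by the
    pigeonhole principle for directions.  In the remaining case the window
    contains [[pi / 3, 2 pi / 3]], and a set without angles in this interval
    has dimension at most 2. *)

(** * A discrete Prekopa-Leindler inequality *)

Lemma amgm_step (R : realFieldType) (p q a b l : R) :
  0 <= p -> 0 <= q -> 0 <= a -> 0 <= b -> 0 <= l ->
  l ^+ 2 <= p * q * (a * b) -> 2 * l <= a * p + b * q.
Proof.
move=> p0 q0 a0 b0 l0 h.
have h2 : (2 * l) ^+ 2 <= (a * p + b * q) ^+ 2.
  have := sqr_ge0 (a * p - b * q); nra.
by move: h2; rewrite ler_sqr ?nnegrE ?addr_ge0 ?mulr_ge0.
Qed.

(* Matching the mass of [f] with the mass of [g] in increasing order visits a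
   monotone path of pairs [(x, y)], hence each value of [x + y] at most once;
   [u] and [v] are the parts of [f 0] and [g 0] that are already matched. *)
Lemma staircase (R : realFieldType) (k X Y : nat) (f g c : nat -> R) (u v : R) :
  (X + Y < k)%N ->
  (forall i, 0 <= f i) -> (forall i, 0 <= g i) -> (forall i, 0 <= c i) ->
  (forall x y, (x <= X)%N -> (y <= Y)%N ->
     f x * g y <= c (x + y)%N * c (x + y).+1) ->
  0 <= u <= 1 -> 0 <= v <= 1 -> u = 0 \/ v = 0 ->
  \sum_(i < X.+1) f i - u * f 0%N = \sum_(i < Y.+1) g i - v * g 0%N ->
  2 * (\sum_(i < X.+1) f i - u * f 0%N) <=
    c 0%N * (1 - u - v) + \sum_(j < (X + Y).+1) c j.+1.
Proof.
elim: k => [//|k IHk] in X Y f g c u v *; move=> XYk f0 g0 c0 fg u01 v01 uv mass.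
(* By symmetry, the unmatched part of [f 0] is used up no later than that of [g 0]. *)
wlog le_fg : X Y f g u v XYk f0 g0 fg u01 v01 uv mass /
    (1 - u) * f 0%N <= (1 - v) * g 0%N => [hw|].
  case: (lerP ((1 - u) * f 0%N) ((1 - v) * g 0%N)) => [|/ltW] h; first exact: (hw X Y f g u v).
  rewrite mass [1 - u - v]addrAC.
  rewrite addnC; apply: (hw Y X g f v u) => //; first by rewrite addnC.
    by move=> x y xX yY; rewrite mulrC addnC fg.
  by case: uv; [right|left].
move: u01 v01 => /andP[u0 u1] /andP[v0 v1].
set l := (1 - u) * f 0%N in le_fg.
have l0 : 0 <= l by rewrite mulr_ge0 ?subr_ge0.
(* [v'] is the matched fraction of [g 0] once the rest [l] of [f 0] has been spent on it; if [g 0]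
   vanishes, so does [l]. *)
pose v' := if g 0%N == 0 then v else v + l / g 0%N.
have [v'0 v'1 v'g] : [/\ 0 <= v', v' <= 1 & v' * g 0%N = v * g 0%N + l].
  rewrite /v'; case: eqVneq => [gz|gz].
    by split => //; move: le_fg; rewrite gz; lra.
  have gp : 0 < g 0%N by rewrite lt_def gz g0.
  split; first by rewrite addr_ge0 ?divr_ge0.
    rewrite -lerBrDl ler_pdivrMr //.
  by rewrite mulrDl divfK.
(* This move is charged to the share [1 - u - v] of [c 0] and the share [v'] of [c 1]; the recursive
   call starts with the share [1 - v'] of [c 1]. *)
have step : 2 * l <= c 0%N * (1 - u - v) + c 1%N * v'.
  have uv1 : 0 <= 1 - u - v by case: uv => ->; lra.
  apply: amgm_step => //.
  apply: (@le_trans _ _ ((1 - u - v) * v' * (f 0%N * g 0%N))); last first.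
    by rewrite ler_wpM2l ?mulr_ge0 // fg.
  rewrite (_ : _ * _ * _ = (1 - u - v) * f 0%N * (v' * g 0%N)); last by ring.
  rewrite v'g; case: uv => [uz|vz].
    rewrite uz subr0 /l uz subr0 mul1r -subr_ge0.
    rewrite (_ : _ - _ = f 0%N * (v * ((1 - v) * g 0%N - l))); last first.
      by rewrite /l uz; ring.
    by rewrite !mulr_ge0 // subr_ge0.
  by rewrite vz subr0 mul0r add0r /l expr2.
case: X XYk fg mass => [|X] XYk fg mass.
  rewrite big_ord_recl big_ord0 addr0 add0n big_ord_recl /=.
  have : 0 <= \sum_(i < Y) c (bump 0 i).+1 by rewrite sumr_ge0.
  have := c0 1%N; rewrite /l in step; nra.
have := IHk X Y (fun i => f i.+1) g (fun i => c i.+1) 0 v' XYk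
  (fun i => f0 _) g0 (fun i => c0 _).
rewrite !mul0r !subr0 => IH.
have {}IH : 2 * (\sum_(i < X.+1) f i.+1) <=
    c 1%N * (1 - v') + \sum_(j < (X + Y).+1) c j.+2.
  apply: IH => //; [|by rewrite lexx ler01|by rewrite v'0|by left|].
    by move=> x y xX yY; have := fg x.+1 y xX yY.
  move: mass; rewrite big_ord_recl /= v'g /l.
  under eq_bigr do rewrite /bump add1n.
  lra.
rewrite big_ord_recl [\sum_(j < (X.+1 + Y).+1) _]big_ord_recl /=.
under eq_bigr do rewrite /bump add1n.
under [X in _ <= _ + (_ + X)]eq_bigr do rewrite /bump add1n.
rewrite /l in step; lra.
Qed.

(** Apply [staircase] to [F] and [G] normalised to mass 1, with [w j./2 / s] for [c j], where [s] is
    the geometric mean of the two masses. *)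
Lemma prekopa_leindler_nat (R : realType) (L : nat) (w F G : nat -> R) :
  (forall i, 0 <= w i) -> (forall i, 0 <= F i) -> (forall i, 0 <= G i) ->
  (forall x y, (x <= L)%N -> (y <= L)%N ->
     F x * G y <= w (x + y)./2 * w (uphalf (x + y))) ->
  (\sum_(i < L.+1) F i) * (\sum_(i < L.+1) G i) <= (\sum_(i < L.+1) w i) ^+ 2.
Proof.
move=> w0 F0 G0 FGw.
set a := \sum_(i < _) F i; set b := \sum_(i < _) G i; set W := \sum_(i < _) w i.
have a0 : 0 <= a by apply: sumr_ge0.
have b0 : 0 <= b by apply: sumr_ge0.
have W0 : 0 <= W by apply: sumr_ge0.
have [->|ab_neq0] := eqVneq (a * b) 0; first by rewrite sqr_ge0.
have ab_gt0 : 0 < a * b by rewrite lt_def ab_neq0 mulr_ge0.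
have /andP[a_gt0 b_gt0] : (0 < a) && (0 < b).
  by move: ab_neq0; rewrite mulf_eq0 negb_or !lt_def a0 b0 !andbT.
pose s := Num.sqrt (a * b).
have s_gt0 : 0 < s by rewrite sqrtr_gt0.
have ss : s * s = a * b by rewrite -expr2 sqr_sqrtr // ltW.
have sumD (c d : R) (H : nat -> R) : \sum_(i < L.+1) H i / d = (\sum_(i < L.+1) H i) / d.
  by rewrite mulr_suml.
have := @staircase R (L + L).+1 L L (fun i => F i / a) (fun i => G i / b)
  (fun j => w j./2 / s) 0 0 (ltnSn _).
rewrite !mul0r !subr0 !sumD // -/a -/b !divff ?gt_eqF // => st.
have {}st : 2 <= w 0%N / s * 1 + \sum_(j < (L + L).+1) w j.+1./2 / s.
  rewrite -[X in X <= _]mulr1; apply: st; rewrite ?lexx ?ler01 //; last by left.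
  - by move=> i; rewrite divr_ge0.
  - by move=> i; rewrite divr_ge0.
  - by move=> i; rewrite divr_ge0 // ltW.
  move=> x y xL yL; rewrite mulrACA -invfM [X in _ <= X]mulrACA -invfM ss.
  by rewrite ler_pM2r ?invr_gt0 //; exact: FGw.
(* As [j] runs from 0 to [2 * L + 1], [j./2] takes each value up to [L] exactly twice. *)
have dbl : w 0%N + \sum_(j < (L + L).+1) w j.+1./2 = 2 * W.
  rewrite /W; elim: (L) => [|K IH].
    by rewrite !big_ord_recl !big_ord0 /=; ring.
  have -> : (K.+1 + K.+1)%N.+1 = (K + K).+3 by rewrite addSn addnS.
  rewrite 2!big_ord_recr /= addrA addrA IH [in RHS]big_ord_recr /=.
  by rewrite addnn uphalf_double doubleK; ring.
move: st; rewrite mulr1 -mulr_suml -mulrDl dbl ler_pdivlMr //.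
rewrite ler_pM2l // => sW; rewrite -ss expr2.
by apply: ler_pM => //; rewrite ltW.
Qed.

(** A Prekopa-Leindler inequality with kernel [phi]; the quantification over all [F] and [G] is what
    lets it pass to products. *)
Definition pl_bound (R : realType) (T : finType) (phi : T -> T -> R) (Z : R) :=
  forall F G : T -> R, (forall a, 0 <= F a) -> (forall a, 0 <= G a) ->
    (forall a b, F a * G b <= phi a b) -> (\sum_a F a) * (\sum_a G a) <= Z.

(** For fixed first components, the bound for [phi2] applied to the sections of [F] and [G] shows
    that their marginals, one of them divided by [Z2], satisfy the hypothesis for [phi1]. *)
Lemma pl_bound_prod (R : realType) (T1 T2 : finType) (phi1 : T1 -> T1 -> R)
    (phi2 : T2 -> T2 -> R) (Z1 Z2 : R) :
  (forall a b, 0 <= phi1 a b) -> 0 < Z2 ->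
  pl_bound phi1 Z1 -> pl_bound phi2 Z2 ->
  pl_bound (fun a b : T1 * T2 => phi1 a.1 b.1 * phi2 a.2 b.2) (Z1 * Z2).
Proof.
move=> phi1_ge0 Z2_gt0 P1 P2 F G F0 G0 FG.
have sumP (H : T1 * T2 -> R) : \sum_p H p = \sum_a \sum_b H (a, b).
  by rewrite pair_bigA; apply: eq_bigr => -[].
rewrite !sumP.
rewrite -ler_pdivrMr // -mulrA [X in _ * X]mulr_suml.
apply: P1 => [a|b|a b]; [by apply: sumr_ge0| |].
  by apply: divr_ge0; [exact: sumr_ge0|exact: ltW].
rewrite mulrA ler_pdivrMr //.
have [phi0|phi_neq0] := eqVneq (phi1 a b) 0.
  rewrite phi0 mul0r mulr_suml; apply: sumr_le0 => i _.
  rewrite mulr_sumr; apply: sumr_le0 => j _.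
  by have := FG (a, i) (b, j); rewrite /= phi0 mul0r.
have phi_gt0 : 0 < phi1 a b by rewrite lt_def phi_neq0 phi1_ge0.
have := P2 (fun i => F (a, i) / phi1 a b) (fun j => G (b, j)).
rewrite -mulr_suml mulrAC ler_pdivrMr // [Z2 * _]mulrC; apply => [i|//|i j].
  by rewrite divr_ge0.
by rewrite mulrAC ler_pdivrMr // [X in _ <= X]mulrC; exact: FG (a, i) (b, j).
Qed.

Definition ffun_cons (T : finType) (n : nat) (p : T * {ffun 'I_n -> T}) :
    {ffun 'I_n.+1 -> T} :=
  [ffun i => if unlift ord0 i is Some j then p.2 j else p.1].

Lemma ffun_cons_bij (T : finType) (n : nat) : bijective (@ffun_cons T n).
Proof.
exists (fun x : {ffun 'I_n.+1 -> T} => (x ord0, [ffun i => x (lift ord0 i)])).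
  move=> [a x]; rewrite /ffun_cons ffunE unlift_none /=; congr (_, _).
  by apply/ffunP => i; rewrite !ffunE liftK.
move=> x; apply/ffunP => i; rewrite ffunE.
by case: unliftP => [j ->|->]; rewrite ?ffunE.
Qed.

Lemma pl_bound_pow (R : realType) (T : finType) (phi : T -> T -> R) (Z : R) (n : nat) :
  (forall a b, 0 <= phi a b) -> 0 < Z -> pl_bound phi Z ->
  pl_bound (fun x y : {ffun 'I_n -> T} => \prod_(i < n) phi (x i) (y i)) (Z ^+ n).
Proof.
move=> phi_ge0 Z_gt0 P1; elim: n => [|n IH] F G F0 G0 FG.
  have one (H : {ffun 'I_0 -> T} -> R) x0 : \sum_x H x = H x0.
    rewrite (bigD1 x0) //= big1 ?addr0 // => x /eqP[]; apply/ffunP; by case.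
  have x0 : {ffun 'I_0 -> T} by apply: finfun; case.
  by rewrite !(one _ x0) expr0; have := FG x0 x0; rewrite big_ord0.
rewrite !(reindex (@ffun_cons T n)) /=; [|exact/onW_bij/ffun_cons_bij..].
rewrite exprS; apply: (pl_bound_prod phi_ge0 _ P1 IH); rewrite ?exprn_gt0 //.
move=> a b; apply: le_trans (FG _ _) _; rewrite big_ord_recl /ffun_cons !ffunE unlift_none.
by under eq_bigr do rewrite !ffunE liftK.
Qed.

(** * Elementary estimates *)

(** The Taylor bounds for [sin] and [cos] below come from it in turn, each one giving the sign of
    the derivative for the next. *)
Lemma ge0_of_derive (R : realType) (f f' : R -> R) :
  (forall x : R, is_derive x 1 f (f' x)) -> (forall x, 0 <= x -> 0 <= f' x) ->
  0 <= f 0 -> forall x, 0 <= x -> 0 <= f x.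
Proof.
move=> df f'_ge0 f0 x x_ge0; apply: le_trans f0 _.
apply: (@ger0_derive1_le_cc _ f 0 x); rewrite ?in_itv/= ?lexx ?x_ge0 //.
  move=> y /itvP yx; rewrite derive1E (@derive_val _ _ _ _ _ _ _ (df y)).
  by rewrite f'_ge0 // yx.
apply/continuous_subspaceT => y; apply/differentiable_continuous.
by apply/derivable1_diffP; exact: ex_derive.
Qed.

Lemma expR_ge_quadratic (R : realType) (x : R) :
  0 <= x -> 1 + x + x ^+ 2 / 2 <= expR x.
Proof.
move=> x0; rewrite -subr_ge0.
apply: (@ge0_of_derive R (fun y => expR y - (1 + y + y ^+ 2 / 2))
  (fun y => expR y - (1 + y))) x0.
- by move=> y; apply: is_derive_eq; rewrite /GRing.scale /=; field.
- by move=> y _; rewrite subr_ge0 expR_ge1Dx.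
by rewrite expR0 expr0n /= mul0r !addr0 subrr.
Qed.

Lemma expRN_le_quadratic (R : realType) (x : R) :
  0 <= x -> expR (- x) <= 1 - x + x ^+ 2 / 2.
Proof.
move=> x0; rewrite expRN -div1r ler_pdivrMr ?expR_gt0 //.
have := expR_ge_quadratic x0; set e := expR x => he.
have h1 : 0 <= 1 - x + x ^+ 2 / 2 by nra.
apply: (@le_trans _ _ ((1 - x + x ^+ 2 / 2) * (1 + x + x ^+ 2 / 2))); last exact: ler_wpM2l.
have := sqr_ge0 (x ^+ 2); nra.
Qed.

Lemma sin_le (R : realType) (x : R) : 0 <= x -> sin x <= x.
Proof.
move=> x0; rewrite -subr_ge0.
apply: (@ge0_of_derive R (fun y => y - sin y) (fun y => 1 - cos y)) x0.
- by move=> y _; rewrite subr_ge0 cos_le1.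
by rewrite sin0 subr0.
Qed.

Lemma cos_ge_quadratic (R : realType) (x : R) : 0 <= x -> 1 - x ^+ 2 / 2 <= cos x.
Proof.
move=> x0; rewrite -subr_ge0.
apply: (@ge0_of_derive R (fun y => cos y - (1 - y ^+ 2 / 2)) (fun y => y - sin y)) x0.
- by move=> y; apply: is_derive_eq; rewrite /GRing.scale /=; field.
- by move=> y y0; rewrite subr_ge0 sin_le.
by rewrite cos0 expr0n /= mul0r subr0 subrr.
Qed.

Lemma sin_ge_cubic (R : realType) (x : R) : 0 <= x -> x - x ^+ 3 / 6 <= sin x.
Proof.
move=> x0; rewrite -subr_ge0.
apply: (@ge0_of_derive R (fun y => sin y - (y - y ^+ 3 / 6))
  (fun y => cos y - (1 - y ^+ 2 / 2))) x0.
- by move=> y; apply: is_derive_eq; rewrite /GRing.scale /=; field.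
- by move=> y y0; rewrite subr_ge0 cos_ge_quadratic.
by rewrite sin0 expr0n /= mul0r !subr0.
Qed.

Lemma cos_le_quartic (R : realType) (x : R) :
  0 <= x -> cos x <= 1 - x ^+ 2 / 2 + x ^+ 4 / 24.
Proof.
move=> x0; rewrite -subr_ge0.
apply: (@ge0_of_derive R (fun y => (1 - y ^+ 2 / 2 + y ^+ 4 / 24) - cos y)
  (fun y => sin y - (y - y ^+ 3 / 6))) x0.
- by move=> y; apply: is_derive_eq; rewrite /GRing.scale /=; field.
- by move=> y y0; rewrite subr_ge0 sin_ge_cubic.
by rewrite cos0 !expr0n /= !mul0r subr0 addr0 subrr.
Qed.

(** Two angle doublings carry a Taylor bound at [31 / 80] to [cos (31 / 20) > 0], whereas [cos]
    vanishes at [pi / 2]. *)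
Lemma pi_gt (R : realType) : 31 / 10 < pi :> R.
Proof.
have c1 : 924 / 1000 <= cos (31 / 80) :> R.
  by apply: le_trans (cos_ge_quadratic _); lra.
have c2 : 7075 / 10000 <= cos (31 / 40) :> R.
  rewrite (_ : 31 / 40 = (31 / 80) *+ 2) ?cos_mulr2n; last by field.
  by rewrite mulr2n; nra.
have c3 : 0 < cos (31 / 20) :> R.
  rewrite (_ : 31 / 20 = (31 / 40) *+ 2) ?cos_mulr2n; last by field.
  by rewrite mulr2n; nra.
have := @pi_ge2 R; rewrite ltNge => pi2; apply/negP => pi31.
suff : cos (31 / 20) <= cos (pi / 2) :> R by rewrite cos_pihalf leNgt c3.
rewrite leNgt ltr_cos ?in_itv /= -?leNgt; lra.
Qed.

(** * Concentration of measure for random pairs *)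

Section bump.
Context {R : realType}.
Implicit Types (L i j : nat).

(** An unnormalised discrete Beta(3, 3) law: strictly log-concave, with explicit moments. *)
Definition bump L i : R := ((i * (L - i)) ^ 2)%:R.

Definition bump_mass L : R := \sum_(i < L.+1) bump L i.

Definition bump_prob L i : R := bump L i / bump_mass L.

Lemma bump_ge0 L i : 0 <= bump L i. Proof. exact: ler0n. Qed.

Lemma bumpE L i : (i <= L)%N -> bump L i = (i%:R * (L%:R - i%:R)) ^+ 2.
Proof. by move=> iL; rewrite /bump natrX natrM natrB. Qed.

Lemma bump_massE L : bump_mass L = (L%:R ^+ 5 - L%:R) / 30.
Proof.
(* Closed form of the partial sums for fixed [L], checked by induction on their length. *)
have part m : (m <= L.+1)%N -> \sum_(i < m) bump L i =
    (- m%:R + 5 * m%:R * L%:R ^+ 2 - 15 * m%:R ^+ 2 * L%:R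
     - 15 * m%:R ^+ 2 * L%:R ^+ 2 + 10 * m%:R ^+ 3 + 30 * m%:R ^+ 3 * L%:R
     + 10 * m%:R ^+ 3 * L%:R ^+ 2 - 15 * m%:R ^+ 4 - 15 * m%:R ^+ 4 * L%:R
     + 6 * m%:R ^+ 5) / 30.
  elim: m => [_|m IH mL]; first by rewrite big_ord0; field.
  by rewrite big_ord_recr /= IH 1?ltnW // bumpE // -natr1; field.
by rewrite /bump_mass part // -natr1; field.
Qed.

Lemma bump_mass_gt0 L : (1 < L)%N -> 0 < bump_mass L.
Proof.
move=> L1; rewrite bump_massE divr_gt0 // subr_gt0.
have : 2 <= L%:R :> R by rewrite ler_nat.
move=> h; rewrite -[X in X < _]expr1 ltr_eXn2l //; lra.
Qed.

Definition centered L i : R := (2 * i%:R - L%:R) / L%:R.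

Definition bump_moment L k : R := \sum_(i < L.+1) bump_prob L i * centered L i ^+ k.

Lemma bump_moment0 L : (1 < L)%N -> bump_moment L 0 = 1.
Proof.
move=> L1; rewrite /bump_moment.
under eq_bigr do rewrite expr0 mulr1.
by rewrite -mulr_suml divff // gt_eqF // bump_mass_gt0.
Qed.

(** The law is symmetric under the exchange of [i] and [L - i], which changes the sign of
    [centered]. *)
Lemma bump_moment_odd L k : odd k -> bump_moment L k = 0.
Proof.
move=> ok; suff : bump_moment L k = - bump_moment L k by lra.
rewrite {1}/bump_moment (reindex_inj rev_ord_inj) /= -sumrN; apply: eq_bigr => i _.
have iL : (i <= L)%N by rewrite -ltnS.
rewrite subSS /bump_prob /bump subKn // [(_ * i)%N]mulnC -mulrN; congr (_ * _).
have sgn : (-1) ^+ k = -1 :> R by rewrite -signr_odd ok.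
rewrite -[RHS]mulN1r -sgn -exprMn; congr (_ ^+ _).
by rewrite /centered natrB //; ring.
Qed.

Lemma bump_moment2 L : (1 < L)%N ->
  bump_moment L 2 = (L%:R ^+ 7 - 21 * L%:R ^+ 3 + 20 * L%:R) /
    (210 * L%:R ^+ 2 * bump_mass L).
Proof.
move=> L1; have m0 := bump_mass_gt0 L1.
have part m : (m <= L.+1)%N -> \sum_(i < m) bump L i * (2 * i%:R - L%:R) ^+ 2 =
    (20 * m%:R - 91 * m%:R * L%:R ^+ 2 + 35 * m%:R * L%:R ^+ 4
     + 210 * m%:R ^+ 2 * L%:R - 315 * m%:R ^+ 2 * L%:R ^+ 3
     - 105 * m%:R ^+ 2 * L%:R ^+ 4 - 140 * m%:R ^+ 3
     + 910 * m%:R ^+ 3 * L%:R ^+ 2 + 630 * m%:R ^+ 3 * L%:R ^+ 3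
     + 70 * m%:R ^+ 3 * L%:R ^+ 4 - 75 * 14 * m%:R ^+ 4 * L%:R
     - 91 * 15 * m%:R ^+ 4 * L%:R ^+ 2 - 315 * m%:R ^+ 4 * L%:R ^+ 3
     + 420 * m%:R ^+ 5 + 90 * 14 * m%:R ^+ 5 * L%:R + 546 * m%:R ^+ 5 * L%:R ^+ 2
     - 420 * m%:R ^+ 6 - 420 * m%:R ^+ 6 * L%:R + 120 * m%:R ^+ 7) / 210.
  elim: m => [_|m IH mL]; first by rewrite big_ord0; field.
  by rewrite big_ord_recr /= IH 1?ltnW // bumpE // -natr1; field.
have L0 : L%:R != 0 :> R by rewrite pnatr_eq0; lia.
have -> : bump_moment L 2 = (\sum_(i < L.+1) bump L i * (2 * i%:R - L%:R) ^+ 2) /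
    (L%:R ^+ 2 * bump_mass L).
  rewrite mulr_suml; apply: eq_bigr => i _; rewrite /bump_prob /centered.
  by field; rewrite L0 gt_eqF.
rewrite part // -natr1; field.
by rewrite L0 gt_eqF.
Qed.

Lemma bump_moment4 L : (1 < L)%N ->
  bump_moment L 4 = (L%:R ^+ 9 - 105 * L%:R ^+ 5 + 440 * L%:R ^+ 3 - 336 * L%:R) /
    (630 * L%:R ^+ 4 * bump_mass L).
Proof.
move=> L1; have m0 := bump_mass_gt0 L1.
have part m : (m <= L.+1)%N -> \sum_(i < m) bump L i * (2 * i%:R - L%:R) ^+ 4 =
    (- 336 * m%:R + 78 * 20 * m%:R * L%:R ^+ 2 - 861 * m%:R * L%:R ^+ 4
     + 105 * m%:R * L%:R ^+ 6 - 96 * 35 * m%:R ^+ 2 * L%:R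
     + 84 * 55 * m%:R ^+ 2 * L%:R ^+ 3 - 75 * 21 * m%:R ^+ 2 * L%:R ^+ 5
     - 315 * m%:R ^+ 2 * L%:R ^+ 6 + 80 * 28 * m%:R ^+ 3
     - 91 * 120 * m%:R ^+ 3 * L%:R ^+ 2 + 82 * 105 * m%:R ^+ 3 * L%:R ^+ 4
     + 90 * 35 * m%:R ^+ 3 * L%:R ^+ 5 + 210 * m%:R ^+ 3 * L%:R ^+ 6
     + 98 * 120 * m%:R ^+ 4 * L%:R - 100 * 231 * m%:R ^+ 4 * L%:R ^+ 3
     - 63 * 205 * m%:R ^+ 4 * L%:R ^+ 4 - 75 * 21 * m%:R ^+ 4 * L%:R ^+ 5
     - 98 * 48 * m%:R ^+ 5 + 91 * 360 * m%:R ^+ 5 * L%:R ^+ 2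
     + 99 * 280 * m%:R ^+ 5 * L%:R ^+ 3 + 82 * 63 * m%:R ^+ 5 * L%:R ^+ 4
     - 98 * 240 * m%:R ^+ 6 * L%:R - 91 * 360 * m%:R ^+ 6 * L%:R ^+ 2
     - 88 * 105 * m%:R ^+ 6 * L%:R ^+ 3 + 96 * 70 * m%:R ^+ 7
     + 96 * 210 * m%:R ^+ 7 * L%:R + 90 * 104 * m%:R ^+ 7 * L%:R ^+ 2
     - 90 * 56 * m%:R ^+ 8 - 90 * 56 * m%:R ^+ 8 * L%:R + 80 * 14 * m%:R ^+ 9) / 630.
  elim: m => [_|m IH mL]; first by rewrite big_ord0; field.
  by rewrite big_ord_recr /= IH 1?ltnW // bumpE // -natr1; field.
have L0 : L%:R != 0 :> R by rewrite pnatr_eq0; lia.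
have -> : bump_moment L 4 = (\sum_(i < L.+1) bump L i * (2 * i%:R - L%:R) ^+ 4) /
    (L%:R ^+ 4 * bump_mass L).
  rewrite mulr_suml; apply: eq_bigr => i _; rewrite /bump_prob /centered.
  by field; rewrite L0 gt_eqF.
rewrite part // -natr1; field.
by rewrite L0 gt_eqF.
Qed.

End bump.

(** * Random configurations: Laplace transform and concentration *)

Section cell.
Context {R : realType}.
Implicit Types (L n : nat).

(** One coordinate of both displacements [u] and [u']; keeping the two together makes their exchange
    at a position a map on cells. *)
Definition cell L := ('I_L.+1 * 'I_L.+1)%type.

Definition cell_prob L (t : cell L) : R := bump_prob L t.1 * bump_prob L t.2.

Definition cell_gap L (t : cell L) : R := centered L t.1 - centered L t.2.

Definition conf_prob L n (x : {ffun 'I_n -> cell L}) : R :=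
  \prod_(i < n) cell_prob (x i).

Definition conf_mass L n (A : {set {ffun 'I_n -> cell L}}) : R :=
  \sum_(x in A) conf_prob x.

Lemma bump_prob_ge0 L i : 0 <= bump_prob L i :> R.
Proof. by rewrite divr_ge0 ?bump_ge0 //; apply: sumr_ge0 => j _; exact: bump_ge0. Qed.

Lemma cell_prob_ge0 L (t : cell L) : 0 <= cell_prob t.
Proof. by rewrite mulr_ge0 ?bump_prob_ge0. Qed.

Lemma conf_prob_ge0 L n (x : {ffun 'I_n -> cell L}) : 0 <= conf_prob x.
Proof. by apply: prodr_ge0 => i _; exact: cell_prob_ge0. Qed.

Lemma sum_cell L (h : 'I_L.+1 -> 'I_L.+1 -> R) :
  \sum_(t : cell L) h t.1 t.2 = \sum_i \sum_j h i j.
Proof. by rewrite pair_bigA. Qed.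

Lemma sum_cell_monomial L a b :
  \sum_(t : cell L) cell_prob t * (centered L t.1 ^+ a * centered L t.2 ^+ b) =
  bump_moment L a * bump_moment L b.
Proof.
rewrite (sum_cell (fun i j : 'I_L.+1 => bump_prob L i * bump_prob L j *
  (centered L i ^+ a * centered L j ^+ b))).
rewrite /bump_moment big_distrlr /=; apply: eq_bigr => i _; apply: eq_bigr => j _.
by rewrite mulrACA.
Qed.

Lemma bump_moment2_bounds L : (10 <= L)%N ->
  57 / 400 <= bump_moment L 2 :> R /\ bump_moment L 2 <= 1 / 7 :> R.
Proof.
move=> L10; have L1 : (1 < L)%N by lia.
have m0 := @bump_mass_gt0 R L L1; rewrite bump_moment2 //.
have l10 : 10 <= L%:R :> R by rewrite ler_nat.
have d0 : 0 < 210 * L%:R ^+ 2 * bump_mass L :> R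
  by apply: mulr_gt0 m0; apply: mulr_gt0; rewrite ?exprn_gt0 ?ltr0n //; lia.
rewrite ler_pdivlMr // ler_pdivrMr // bump_massE.
set l := L%:R in l10 *.
have l2 : 100 <= l ^+ 2 by nra.
have l4 : 90 * 100 <= l ^+ 4 by rewrite (exprM l 2 2); nra.
have l3 : 0 <= l ^+ 3 by rewrite exprn_ge0 //; lra.
split; rewrite -subr_ge0.
  rewrite (_ : _ - _ = l ^+ 3 * (l ^+ 4 - (90 * 100 - 999)) / 400 + 20 * l); last by field.
  have a0 : 0 <= l ^+ 4 - (90 * 100 - 999) by lra.
  have := divr_ge0 (mulr_ge0 l3 a0) (ler0n R 400); lra.
rewrite (_ : _ - _ = 20 * (l ^+ 3 - l)); last by field.
have : 0 <= l ^+ 2 by rewrite exprn_ge0 //; lra.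
nra.
Qed.

Lemma bump_moment4_le L : (10 <= L)%N -> bump_moment L 4 <= 1 / 21 :> R.
Proof.
move=> L10; have L1 : (1 < L)%N by lia.
have m0 := @bump_mass_gt0 R L L1; rewrite bump_moment4 //.
have l10 : 10 <= L%:R :> R by rewrite ler_nat.
have d0 : 0 < 630 * L%:R ^+ 4 * bump_mass L :> R
  by apply: mulr_gt0 m0; apply: mulr_gt0; rewrite ?exprn_gt0 ?ltr0n //; lia.
rewrite ler_pdivrMr // bump_massE.
set l := L%:R in l10 *.
have l3 : 0 <= l ^+ 3 by rewrite exprn_ge0 //; lra.
have l2 : 100 <= l ^+ 2 by nra.
rewrite -subr_ge0 (_ : _ - _ = l ^+ 3 * (104 * l ^+ 2 - 440) + 336 * l); last by field.
have a0 : 0 <= 104 * l ^+ 2 - 440 by lra.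
by have := mulr_ge0 l3 a0; lra.
Qed.

(** With [p] and [q] the second and fourth moments, the quadratic bound on [expR] gives
    [1 - p + q / 4 + 3 / 4 * p ^ 2], because odd moments vanish. Near [p = 1 / 7], [q = 1 / 21] this
    is below [1 - 23 / 200]. *)
Lemma cell_laplace L : (10 <= L)%N ->
  \sum_(t : cell L) cell_prob t * expR (- (cell_gap t ^+ 2 / 2)) <= expR (- (23 / 200)).
Proof.
move=> L10; have L1 : (1 < L)%N by lia.
apply: (@le_trans _ _ (\sum_(t : cell L) cell_prob t *
    (1 - cell_gap t ^+ 2 / 2 + (cell_gap t ^+ 2 / 2) ^+ 2 / 2))).
  apply: ler_sum => t _; rewrite ler_wpM2l ?cell_prob_ge0 //.
  by rewrite expRN_le_quadratic // divr_ge0 ?sqr_ge0.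
pose m a b (t : cell L) := cell_prob t * (centered L t.1 ^+ a * centered L t.2 ^+ b).
have -> : \sum_(t : cell L) cell_prob t *
    (1 - cell_gap t ^+ 2 / 2 + (cell_gap t ^+ 2 / 2) ^+ 2 / 2) =
   \sum_(t : cell L) (m 0%N 0%N t - 2^-1 * m 2%N 0%N t - 2^-1 * m 0%N 2%N t + m 1%N 1%N t
     + 8^-1 * m 4%N 0%N t + 8^-1 * m 0%N 4%N t + 6 / 8 * m 2%N 2%N t - 4 / 8 * m 3%N 1%N t
     - 4 / 8 * m 1%N 3%N t).
  by apply: eq_bigr => t _; rewrite /m /cell_gap; field.
rewrite !(big_split, sumrN) /= -!mulr_sumr !sum_cell_monomial.
rewrite !bump_moment0 // !(@bump_moment_odd _ _ 1) // !(@bump_moment_odd _ _ 3) //.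
have [lo up] := bump_moment2_bounds L10; have m4 := bump_moment4_le L10.
have := expR_ge1Dx (- (23 / 200) : R).
set e := expR _; set p := bump_moment L 2 in lo up *.
have : 0 <= (p - 57 / 400) * (1 / 7 - p) by rewrite mulr_ge0 ?subr_ge0.
lra.
Qed.

(* The factor [s ^+ 2 - D'] absorbs the exponential since [1 - t <= expR (- t)]. *)
Lemma sub_le_mul_expR (s D D' : R) : 0 < s -> 0 <= D' -> D' <= D -> D <= s ^+ 2 ->
  s ^+ 2 - D <= (s ^+ 2 - D') * expR (- ((D - D') / s ^+ 2)).
Proof.
move=> s0 D'0 D'D Ds.
have s2 : 0 < s ^+ 2 by rewrite exprn_gt0.
apply: (@le_trans _ _ ((s ^+ 2 - D') * (1 - (D - D') / s ^+ 2))); last first.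
  by rewrite ler_wpM2l ?expR_ge1Dx // subr_ge0 (le_trans D'D).
rewrite -subr_ge0 (_ : _ - _ = D' * (D - D') / s ^+ 2); last first.
  by field; rewrite gt_eqF.
by rewrite divr_ge0 ?mulr_ge0 ?subr_ge0 // ltW.
Qed.

(** With [s = x + y], [s' = 2 * L - s] and [u = x - y], the product [x (L - x) y (L - y)] is
    [(s ^ 2 - u ^ 2) (s' ^ 2 - u ^ 2) / 16]; at the rounded midpoints [u] becomes [v] with
    [v ^ 2 <= 1]. Since [s * s' <= L ^ 2], this replacement gains a factor
    [expR (2 * (u ^ 2 - v ^ 2) / L ^ 2)], which [bump] squares. *)
Lemma bump_log_concave L x y : (0 < L)%N -> (x <= L)%N -> (y <= L)%N ->
  bump L x * bump L y * expR (4 * ((x%:R - y%:R) ^+ 2 - 1) / L%:R ^+ 2) <=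
  bump L (x + y)./2 * bump L (uphalf (x + y)) :> R.
Proof.
move=> L_gt0 xL yL.
have [z0|z_gt0] := posnP (x + y).
  have [-> ->] : (x = 0 /\ y = 0)%N by lia.
  by rewrite /bump mul0n !mul0r.
have [z2|z_lt] := eqVneq (x + y)%N (L + L)%N.
  have [-> ->] : (x = L /\ y = L)%N by lia.
  by rewrite /bump subnn muln0 !mul0r mulr_ge0.
set a := (x + y)./2; set b := uphalf (x + y).
have [ab ba] : (a + b = x + y)%N /\ (b = a \/ b = a.+1).
  by rewrite /a /b; have := odd_double_half (x + y); case: odd => /=; lia.
have sE : (x + y)%:R = x%:R + y%:R :> R by rewrite natrD.
set u := x%:R - y%:R; set v := a%:R - b%:R : R.
have v2 : v ^+ 2 <= 1.
  by rewrite /v; case: ba => ->; [rewrite subrr expr0n|rewrite -natr1; nra].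
have [|neq_xy] := eqVneq x y.
  move=> xy; have -> : a = x by rewrite /a xy addnn doubleK.
  have -> : b = x by rewrite /b xy addnn uphalf_double.
  rewrite /u xy subrr expr0n /= sub0r mulrN1 mulNr -[X in _ <= X]mulr1.
  by rewrite ler_wpM2l ?mulr_ge0 ?bump_ge0 // expR_le1.
have u2 : 1 <= u ^+ 2.
  rewrite /u; case: (ltngtP x y) neq_xy => // xy _.
    have : x%:R + 1 <= y%:R :> R by rewrite natr1 ler_nat.
    nra.
  have : y%:R + 1 <= x%:R :> R by rewrite natr1 ler_nat.
  nra.
have vu : v ^+ 2 <= u ^+ 2 by apply: le_trans u2.
pose s : R := x%:R + y%:R; pose s' : R := 2 * L%:R - s.
have xR : 0 <= (x%:R : R) <= L%:R by rewrite ler0n ler_nat.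
have yR : 0 <= (y%:R : R) <= L%:R by rewrite ler0n ler_nat.
have abR : a%:R + b%:R = s by rewrite -natrD ab natrD.
have aL : (a <= L)%N by rewrite /a; lia.
have bL : (b <= L)%N by rewrite /b; lia.
have s_gt0 : 0 < s by rewrite /s -natrD ltr0n.
have s'_gt0 : 0 < s'.
  rewrite /s' /s subr_gt0 -natrD -natrM ltr_nat; lia.
have us : u ^+ 2 <= s ^+ 2 by rewrite /u /s; nra.
have us' : u ^+ 2 <= s' ^+ 2 by rewrite /u /s' /s; nra.
have h1 := sub_le_mul_expR s_gt0 (sqr_ge0 v) vu us.
have h2 := sub_le_mul_expR s'_gt0 (sqr_ge0 v) vu us'.
rewrite !bumpE // -!exprMn.
have exy : x%:R * (L%:R - x%:R) * (y%:R * (L%:R - y%:R)) =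
    (s ^+ 2 - u ^+ 2) * (s' ^+ 2 - u ^+ 2) / 16 :> R by rewrite /s' /s /u; field.
have eab : a%:R * (L%:R - a%:R) * (b%:R * (L%:R - b%:R)) =
    (s ^+ 2 - v ^+ 2) * (s' ^+ 2 - v ^+ 2) / 16 :> R by rewrite /s' -abR /v; field.
rewrite exy eab.
set d := u ^+ 2 - v ^+ 2 in h1 h2.
have d_ge0 : 0 <= d by rewrite subr_ge0.
have l_gt0 : 0 < L%:R :> R by rewrite ltr0n.
pose K : R := expR (- (2 * d / L%:R ^+ 2)).
have KE : expR (- (d / s ^+ 2)) * expR (- (d / s' ^+ 2)) <= K.
  rewrite -expRD ler_expR -opprD lerN2 -[X in _ <= X]mulrDr [2 * d]mulrC -mulrA.
  rewrite ler_wpM2l // -!exprVn.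
  have : s * s' <= L%:R ^+ 2 by have := sqr_ge0 (s - s'); rewrite /s'; nra.
  rewrite -lef_pV2 ?posrE ?exprn_gt0 ?mulr_gt0 // invfM exprVn.
  have := sqr_ge0 (s^-1 - s'^-1); nra.
have PQ : (s ^+ 2 - u ^+ 2) * (s' ^+ 2 - u ^+ 2) / 16 <=
    (s ^+ 2 - v ^+ 2) * (s' ^+ 2 - v ^+ 2) / 16 * K.
  rewrite [X in _ <= X]mulrAC ler_pM2r ?invr_gt0 //.
  apply: le_trans (ler_pM _ _ h1 h2) _; rewrite ?subr_ge0 // mulrACA.
  by rewrite ler_wpM2l // mulr_ge0 // subr_ge0 (le_trans vu).
have K2 : K ^+ 2 * expR (4 * (u ^+ 2 - 1) / L%:R ^+ 2) <= 1.
  rewrite expr2 -!expRD expR_le1 (_ : _ + _ = 4 * (v ^+ 2 - 1) / L%:R ^+ 2).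
    by rewrite mulr_le0_ge0 ?invr_ge0 ?exprn_ge0 // mulr_ge0_le0 // subr_le0.
  by rewrite /d; field; rewrite gt_eqF.
have PQ0 : 0 <= (s ^+ 2 - u ^+ 2) * (s' ^+ 2 - u ^+ 2) / 16.
  by rewrite divr_ge0 ?mulr_ge0 ?subr_ge0.
apply: (@le_trans _ _ (((s ^+ 2 - v ^+ 2) * (s' ^+ 2 - v ^+ 2) / 16 * K) ^+ 2 *
   expR (4 * (u ^+ 2 - 1) / L%:R ^+ 2))).
  by rewrite ler_pM2r ?expR_gt0 // lerXn2r ?nnegrE // (le_trans PQ0).
set T := (s ^+ 2 - v ^+ 2) * _ / 16.
by rewrite [(T * K) ^+ 2]exprMn -[X in X <= _]mulrA ler_piMr ?sqr_ge0.
Qed.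

(** The exponent gained from log-concavity in the two coordinates; each [- 1] is the loss from
    rounding a midpoint. *)
Definition cell_cost L (t t' : cell L) : R :=
  4 * ((t.1%:R - t'.1%:R) ^+ 2 - 1) / L%:R ^+ 2 +
  4 * ((t.2%:R - t'.2%:R) ^+ 2 - 1) / L%:R ^+ 2.

Lemma sum_bump_prob L : (1 < L)%N -> \sum_(i < L.+1) bump_prob L i = 1 :> R.
Proof. by move=> L1; rewrite -mulr_suml divff // gt_eqF // bump_mass_gt0. Qed.

Lemma pl_bound_bump L : (1 < L)%N ->
  pl_bound (fun i j : 'I_L.+1 => bump_prob L i * bump_prob L j *
    expR (4 * ((i%:R - j%:R) ^+ 2 - 1) / L%:R ^+ 2)) (1 : R).
Proof.
move=> L1 F G F0 G0 FG.
have := @prekopa_leindler_nat R L (bump_prob L)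
  (fun i => F (inord i)) (fun i => G (inord i)).
under [\sum_(i < L.+1) F _]eq_bigr do rewrite inord_val.
under [\sum_(i < L.+1) G _]eq_bigr do rewrite inord_val.
rewrite sum_bump_prob // expr1n; apply => // [i|x y xL yL]; first exact: bump_prob_ge0.
apply: le_trans (FG _ _) _; rewrite !inordK //.
rewrite /bump_prob mulrACA -invfM [X in _ <= X]mulrACA -invfM.
rewrite [X in X <= _]mulrAC ler_pM2r ?invr_gt0 ?mulr_gt0 ?bump_mass_gt0 //.
by rewrite bump_log_concave //; lia.
Qed.

(** The product inequality is applied to the law restricted to [A] and to [expR tau] times the law
    restricted to [B]. *)
Lemma conf_concentration L n (A B : {set {ffun 'I_n -> cell L}}) (tau : R) :
  (1 < L)%N ->
  (forall x y, x \in A -> y \in B -> tau <= \sum_(i < n) cell_cost (x i) (y i)) ->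
  conf_mass A * conf_mass B * expR tau <= 1.
Proof.
move=> L1 AB.
pose phi (t t' : cell L) : R := cell_prob t * cell_prob t' * expR (cell_cost t t').
have phi_ge0 t t' : 0 <= phi t t'.
  by rewrite mulr_ge0 ?expR_ge0 // mulr_ge0 ?cell_prob_ge0.
have Pphi : pl_bound phi 1.
  have P1 := pl_bound_bump L1.
  have := pl_bound_prod _ ltr01 P1 P1; rewrite mulr1 => P2 F G F0 G0 FG.
  apply: P2 => // [a b|a b].
    by rewrite mulr_ge0 ?expR_ge0 // mulr_ge0 ?bump_prob_ge0.
  apply: le_trans (FG a b) _; rewrite le_eqVlt; apply/orP; left; apply/eqP.
  by rewrite /phi /cell_prob /cell_cost expRD; ring.
have := @pl_bound_pow _ _ _ _ n phi_ge0 ltr01 Pphi; rewrite expr1n => P.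
have := P (fun x => if x \in A then conf_prob x else 0)
  (fun x => if x \in B then conf_prob x * expR tau else 0).
rewrite -!big_mkcond /= -mulr_suml mulrA; apply => [x|x|x y].
- by case: ifP => // _; exact: conf_prob_ge0.
- by case: ifP => // _; rewrite mulr_ge0 ?expR_ge0 ?conf_prob_ge0.
case: ifP => xA; last by rewrite mul0r prodr_ge0.
case: ifP => yB; last by rewrite mulr0 prodr_ge0.
have -> : \prod_(i < n) phi (x i) (y i) = conf_prob x * conf_prob y *
    expR (\sum_(i < n) cell_cost (x i) (y i)) by rewrite expR_sum -!big_split.
by rewrite mulrA ler_wpM2l ?mulr_ge0 ?conf_prob_ge0 // ler_expR AB.
Qed.

(** Chernoff's method: the indicator of the event is at most [expR] of [9 / 100 * n] minus half the
    sum, whose expectation factors over the cells; [9 / 100 - 23 / 200] is [- 1 / 40]. *)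
Lemma conf_mass_small_gap L n : (10 <= L)%N ->
  conf_mass [set x : {ffun 'I_n -> cell L} |
    \sum_(i < n) cell_gap (x i) ^+ 2 < 18 / 100 * n%:R] <= expR (- (n%:R / 40)) :> R.
Proof.
move=> L10.
have ct : expR (9 / 100) ^+ n * expR (- (23 / 200)) ^+ n = expR (- (n%:R / 40)) :> R.
  by rewrite -!expRM_natr -expRD; congr expR; field.
rewrite -ct.
apply: (@le_trans _ _ (\sum_(x : {ffun 'I_n -> cell L}) expR (9 / 100) ^+ n *
    \prod_(i < n) (cell_prob (x i) * expR (- (cell_gap (x i) ^+ 2 / 2))))).
  rewrite /conf_mass big_mkcond /=; apply: ler_sum => x _.
  have p0 := conf_prob_ge0 x.
  rewrite inE; case: ifP => [lt|_]; last first.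
    by rewrite mulr_ge0 ?exprn_ge0 ?expR_ge0 // prodr_ge0 // => i _; rewrite mulr_ge0 ?expR_ge0 ?cell_prob_ge0.
  rewrite big_split /= mulrCA -[X in X <= _]mulr1 ler_wpM2l // -expR_sum -expRM_natr -expRD.
  rewrite -[X in X <= _]expR0 ler_expR sumrN -mulr_suml; lra.
rewrite -mulr_sumr -(bigA_distr_bigA (fun (i : 'I_n) t => cell_prob t *
  expR (- (cell_gap t ^+ 2 / 2)))) /= ler_wpM2l ?exprn_ge0 ?expR_ge0 //.
rewrite prodr_const card_ord lerXn2r ?nnegrE ?expR_ge0 //; last exact: cell_laplace.
by apply: sumr_ge0 => t _; rewrite mulr_ge0 ?expR_ge0 ?cell_prob_ge0.
Qed.

End cell.

(** * Euclidean angles *)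

Section euclid.
Context {R : realType} {n : nat}.
Implicit Types (x y z p q r : 'rV[R]_n).

Lemma dotvC x y : dotv x y = dotv y x.
Proof. by apply: eq_bigr => i _; rewrite mulrC. Qed.

Lemma dotvDl x y z : dotv (x + y) z = dotv x z + dotv y z.
Proof. by rewrite /dotv -big_split; apply: eq_bigr => i _; rewrite mxE mulrDl. Qed.

Lemma dotvZl (a : R) x y : dotv (a *: x) y = a * dotv x y.
Proof. by rewrite /dotv mulr_sumr; apply: eq_bigr => i _; rewrite mxE mulrA. Qed.

Lemma dotvDr x y z : dotv z (x + y) = dotv z x + dotv z y.
Proof. by rewrite !(dotvC z) dotvDl. Qed.

Lemma dotvZr (a : R) x y : dotv y (a *: x) = a * dotv y x.
Proof. by rewrite !(dotvC y) dotvZl. Qed.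

Lemma dotvNl x y : dotv (- x) y = - dotv x y.
Proof. by rewrite -scaleN1r dotvZl mulN1r. Qed.

Lemma dotvNr x y : dotv y (- x) = - dotv y x.
Proof. by rewrite !(dotvC y) dotvNl. Qed.

Definition dotvE := (dotvDl, dotvDr, dotvNl, dotvNr, dotvZl, dotvZr).

Lemma dotv_ge0 x : 0 <= dotv x x.
Proof. by apply: sumr_ge0 => i _; rewrite -expr2 sqr_ge0. Qed.

Lemma dotv_eq0 x : (dotv x x == 0) = (x == 0).
Proof.
apply/eqP/eqP => [x0|->]; last by rewrite -(scale0r 0) dotvZl mul0r.
apply/rowP => i; rewrite mxE; apply/eqP; rewrite -sqrf_eq0 expr2; apply/eqP.
by apply: (psumr_eq0P _ x0) => // j _; rewrite -expr2 sqr_ge0.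
Qed.

Lemma dotv_gt0 x : x != 0 -> 0 < dotv x x.
Proof. by move=> x0; rewrite lt_def dotv_eq0 x0 dotv_ge0. Qed.

Lemma enorm_ge0 x : 0 <= enorm x. Proof. exact: sqrtr_ge0. Qed.

Lemma enorm_sqr x : enorm x ^+ 2 = dotv x x.
Proof. by rewrite sqr_sqrtr // dotv_ge0. Qed.

Lemma enorm_gt0 x : x != 0 -> 0 < enorm x.
Proof. by move=> x0; rewrite sqrtr_gt0 dotv_gt0. Qed.

Lemma enormN x : enorm (- x) = enorm x.
Proof. by rewrite /enorm !dotvE opprK. Qed.

Lemma enormZ (a : R) x : enorm (a *: x) = `|a| * enorm x.
Proof. by rewrite /enorm !dotvE mulrA -expr2 sqrtrM ?sqr_ge0 // sqrtr_sqr. Qed.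

Lemma cauchy_schwarz x y : dotv x y ^+ 2 <= dotv x x * dotv y y.
Proof.
have [->|y0] := eqVneq y 0.
  by rewrite -(scale0r 0) !dotvE !mul0r mulr0 expr0n.
have := dotv_ge0 (dotv y y *: x - dotv x y *: y); rewrite !dotvE (dotvC y x).
have := dotv_gt0 y0; set a := dotv x x; set b := dotv y y; set c := dotv x y.
move=> b0; rewrite (_ : _ + _ = b * (a * b - c ^+ 2)); last by ring.
by rewrite pmulr_rge0 // subr_ge0.
Qed.

Lemma dotv_le_enorm x y : dotv x y <= enorm x * enorm y.
Proof.
apply: le_trans (ler_norm _) _; rewrite -[X in _ <= X]ger0_norm ?mulr_ge0 ?enorm_ge0 //.
by rewrite -ler_sqr ?nnegrE ?normr_ge0 // !real_normK ?num_real // exprMn !enorm_sqr cauchy_schwarz.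
Qed.

Lemma enormD x y : enorm (x + y) <= enorm x + enorm y.
Proof.
rewrite -ler_sqr ?nnegrE ?addr_ge0 ?enorm_ge0 // sqrrD !enorm_sqr !dotvE (dotvC y x).
by have := dotv_le_enorm x y; rewrite mulr2n; lra.
Qed.

Definition vangle x y : R := acos (dotv x y / (enorm x * enorm y)).

Lemma angleE x y z : angle x y z = vangle (x - y) (z - y).
Proof. by []. Qed.

Definition vcos x y : R := dotv x y / (enorm x * enorm y).

Lemma vcos_itv x y : x != 0 -> y != 0 -> -1 <= vcos x y <= 1.
Proof.
move=> x0 y0; have d0 : 0 < enorm x * enorm y by rewrite mulr_gt0 ?enorm_gt0.
rewrite ler_pdivrMr // mul1r dotv_le_enorm andbT ler_pdivlMr // mulN1r.
by rewrite lerNl -dotvNl -(enormN x) dotv_le_enorm.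
Qed.

Lemma vangle_itv x y : x != 0 -> y != 0 -> 0 <= vangle x y <= pi.
Proof. by move=> x0 y0; rewrite acos_ge0 ?acos_lepi // vcos_itv. Qed.

Lemma cos_vangle x y : x != 0 -> y != 0 -> cos (vangle x y) = vcos x y.
Proof. by move=> x0 y0; rewrite acosK // in_itv/= vcos_itv. Qed.

Lemma vangleC x y : vangle x y = vangle y x.
Proof. by rewrite /vangle dotvC mulrC [enorm y * _]mulrC mulrC. Qed.

Lemma vangleZ (a b : R) x y : 0 < a -> 0 < b -> vangle (a *: x) (b *: y) = vangle x y.
Proof.
move=> a0 b0; rewrite /vangle !dotvE !enormZ !gtr0_norm //; congr acos.
by rewrite mulrACA mulrA -mulf_div divff ?mul1r // mulf_neq0 ?gt_eqF.
Qed.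

Lemma le_vangle x y (t : R) : x != 0 -> y != 0 -> 0 <= t <= pi ->
  (vangle x y <= t) = (cos t <= vcos x y).
Proof.
move=> x0 y0 tpi; rewrite -cos_vangle // !leNgt ltr_cos // in_itv/=.
exact: vangle_itv.
Qed.

Lemma lt_vangle x y (t : R) : x != 0 -> y != 0 -> 0 <= t <= pi ->
  (vangle x y < t) = (cos t < vcos x y).
Proof.
by move=> x0 y0 tpi; rewrite -cos_vangle // ltr_cos ?in_itv //= vangle_itv.
Qed.

Lemma ge_vangle x y (t : R) : x != 0 -> y != 0 -> 0 <= t <= pi ->
  (t <= vangle x y) = (vcos x y <= cos t).
Proof. by move=> x0 y0 tpi; rewrite !leNgt lt_vangle. Qed.

Lemma gt_vangle x y (t : R) : x != 0 -> y != 0 -> 0 <= t <= pi ->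
  (t < vangle x y) = (vcos x y < cos t).
Proof. by move=> x0 y0 tpi; rewrite !ltNge le_vangle. Qed.

Lemma vcosxx x : x != 0 -> vcos x x = 1.
Proof.
by move=> x0; rewrite /vcos -enorm_sqr expr2 divff // mulf_neq0 ?gt_eqF ?enorm_gt0.
Qed.

Lemma vcosC x y : vcos x y = vcos y x.
Proof. by rewrite /vcos dotvC [enorm y * _]mulrC. Qed.

(** Normalised vectors make [vcos] bilinear, so that Cauchy-Schwarz yields polynomial inequalities
    between cosines. *)
Lemma unit_vectors : exists u : 'rV[R]_n -> 'rV[R]_n,
  forall x y, dotv (u x) (u y) = vcos x y.
Proof.
by exists (fun x => (enorm x)^-1 *: x) => x y; rewrite !dotvE /vcos invfM; ring.
Qed.

Lemma dotvBB x y : dotv (x - y) (x - y) = dotv x x - 2 * dotv x y + dotv y y.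
Proof. by rewrite !dotvE (dotvC y x); ring. Qed.

Lemma dotv_polar x y :
  dotv x y = (dotv x x + dotv y y - dotv (y - x) (y - x)) / 2.
Proof. by rewrite !dotvE (dotvC y x); field. Qed.

(** Cauchy-Schwarz for the components of the unit vectors of [x] and [z] orthogonal to that of [y]
    bounds [vcos x z] below by the cosine of the sum of the two angles. *)
Lemma vangle_triangle x y z : x != 0 -> y != 0 -> z != 0 ->
  vangle x z <= vangle x y + vangle y z.
Proof.
move=> x0 y0 z0.
have /andP[a0 api] := vangle_itv x0 y0; have /andP[b0 bpi] := vangle_itv y0 z0.
have [pi_le|lt_pi] := lerP pi (vangle x y + vangle y z).
  by apply: le_trans pi_le; case/andP: (vangle_itv x0 z0).
rewrite le_vangle //; last by rewrite addr_ge0 //= ltW.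
rewrite cosD.
have s0 : 0 <= sin (vangle x y) * sin (vangle y z).
  by rewrite mulr_ge0 // sin_ge0_pi ?a0 ?b0.
suff : (vcos x y * vcos y z - vcos x z) ^+ 2 <= (sin (vangle x y) * sin (vangle y z)) ^+ 2.
  move=> h; rewrite !cos_vangle // lerBlDl -lerBlDr.
  apply: le_trans (ler_norm _) _; rewrite -(ger0_norm s0).
  by rewrite -ler_sqr ?nnegrE ?normr_ge0 // !real_normK ?num_real.
rewrite exprMn !sin2cos2 !cos_vangle //.
have [u uu] := unit_vectors.
have := cauchy_schwarz (u x - vcos x y *: u y) (u z - vcos y z *: u y).
rewrite !dotvE !uu !vcosxx // (vcosC y x) (vcosC z y); lra.
Qed.

(* Law of cosines with [2 |x| |y| <= |x|^2 + |y|^2]. *)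
Lemma vcos_ge x y : x != 0 -> y != 0 ->
  1 - dotv (x - y) (x - y) / (2 * (enorm x * enorm y)) <= vcos x y.
Proof.
move=> x0 y0; have d0 : 0 < enorm x * enorm y by rewrite mulr_gt0 ?enorm_gt0.
rewrite -subr_ge0 /vcos !dotvE (dotvC y x) -!enorm_sqr.
set a := enorm x in d0 *; set b := enorm y in d0 *.
rewrite (_ : _ - _ = (a - b) ^+ 2 / (2 * (a * b))).
  by rewrite divr_ge0 ?sqr_ge0 // mulr_ge0 // ltW.
by field; move: d0; rewrite pmulr_rgt0 ?enorm_gt0 // => b0; rewrite !gt_eqF ?enorm_gt0.
Qed.

(** The right-hand factor is twice [t ^ 2 / 2 - t ^ 4 / 24], the quartic lower bound for
    [1 - cos t]. *)
Lemma vangle_le_small x y (t : R) : x != 0 -> y != 0 -> 0 <= t <= 1 ->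
  dotv (x - y) (x - y) <= t ^+ 2 * (1 - t ^+ 2 / 12) * (enorm x * enorm y) ->
  vangle x y <= t.
Proof.
move=> x0 y0 /andP[t0 t1] h; have d0 : 0 < enorm x * enorm y by rewrite mulr_gt0 ?enorm_gt0.
have := @pi_gt R => pi3.
rewrite le_vangle ?t0 //=; last by lra.
apply: le_trans (vcos_ge x0 y0); apply: le_trans (cos_le_quartic t0) _.
have : dotv (x - y) (x - y) / (2 * (enorm x * enorm y)) <= t ^+ 2 * (1 - t ^+ 2 / 12) / 2.
  rewrite ler_pdivrMr; last by rewrite mulr_gt0.
  by apply: le_trans h _; rewrite le_eqVlt; apply/orP; left; apply/eqP; field.
lra.
Qed.

End euclid.

(** * Upper bounds for the Hausdorff dimension *)

Section cover.
Context {R : realType} {n : nat}.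
Implicit Types (E U : set 'rV[R]_n) (z : {ffun 'I_n -> int}) (q s : nat).

(** Half-open cubes of side [1 / q], so that those inside the unit cube at [z] partition it. *)
Definition cube z q (w : 'I_n -> nat) : set 'rV[R]_n :=
  [set e | forall i, (z i)%:~R + (w i)%:R / q%:R <= e ord0 i <
                     (z i)%:~R + ((w i)%:R + 1) / q%:R].

Definition occupied E z q : {set {ffun 'I_n -> 'I_q}} :=
  [set w : {ffun 'I_n -> 'I_q} | `[< exists2 e, E e & cube z q (fun i => w i) e >]]%SET.

Lemma cube_dist z q w x y i : (0 < q)%N -> cube z q w x -> cube z q w y ->
  `|x ord0 i - y ord0 i| <= q%:R^-1.
Proof.
move=> q0 /(_ i) /andP[x1 x2] /(_ i) /andP[y1 y2].
rewrite mulrDl mul1r in x2 y2; rewrite ler_norml; apply/andP; split; lra.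
Qed.

Lemma enorm_le (b : R) (x : 'rV[R]_n) : 0 <= b -> (forall i, `|x ord0 i| <= b) ->
  enorm x <= Num.sqrt n%:R * b.
Proof.
move=> b0 xb; rewrite -[b]ger0_norm // -sqrtr_sqr -sqrtrM // ler_wsqrtr //.
rewrite /dotv mulr_natl -[X in _ *+ X]card_ord -sumr_const; apply: ler_sum => i _.
by rewrite -expr2 -real_normK ?num_real // lerXn2r ?nnegrE.
Qed.

Lemma diam_ge0 U : (0 <= diam U)%E.
Proof. by apply: ereal_sup_ubound; left. Qed.

Lemma diam_cube z q w : (0 < q)%N ->
  (diam (cube z q w) <= (Num.sqrt n%:R / q%:R)%:E)%E.
Proof.
move=> q0; apply: ge_ereal_sup => _ [->|[[x y] [/= xw yw] <-]].
  by rewrite lee_fin divr_ge0 ?sqrtr_ge0.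
rewrite lee_fin; apply: enorm_le => [|i]; first by rewrite invr_ge0.
by rewrite !mxE; exact: cube_dist xw yw.
Qed.

Lemma diam_pow_ge0 (t : R) U : (0 <= diam_pow t U)%E.
Proof. by rewrite /diam_pow; case: ifP => // _; exact: poweR_ge0. Qed.

Lemma diam_pow_cube (t : R) z q w : (0 < q)%N -> 0 <= t ->
  (diam_pow t (cube z q w) <= ((Num.sqrt n%:R / q%:R) `^ t)%:E)%E.
Proof.
move=> q0 t0; rewrite /diam_pow; case: ifP => _; first by rewrite lee_fin powR_ge0.
rewrite -poweR_EFin; apply: gt0_ler_poweR => //; last exact: diam_cube.
  by rewrite in_itv/= diam_ge0 leey.
by rewrite in_itv/= leey lee_fin divr_ge0 ?sqrtr_ge0.
Qed.

Lemma cube_cover z q (e : 'rV[R]_n) : (0 < q)%N ->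
  (forall i, z i = Num.floor (e ord0 i)) ->
  exists w : {ffun 'I_n -> 'I_q}, cube z q (fun i => w i) e.
Proof.
move=> q0 ze.
have q0' : 0 < q%:R :> R by rewrite ltr0n.
pose a i := Num.trunc ((e ord0 i - (z i)%:~R) * q%:R).
have fr i : 0 <= e ord0 i - (z i)%:~R < 1.
  have := floor_itv (e ord0 i).
  by rewrite -ze intrD => /andP[h1 h2]; rewrite subr_ge0 h1 /= ltrBlDl.
have ab i : (a i)%:R <= (e ord0 i - (z i)%:~R) * q%:R < (a i).+1%:R.
  have /andP[f0 _] := fr i.
  by apply: truncn_itv; rewrite mulr_ge0.
have aq i : (a i < q)%N.
  have /andP[_ f1] := fr i; have /andP[a1 _] := ab i.
  rewrite -(ltr_nat R); apply: le_lt_trans a1 _.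
  by rewrite -[X in _ < X]mul1r ltr_pM2r.
exists [ffun i => Ordinal (aq i)] => i; rewrite ffunE /=.
have /andP[a1 a2] := ab i; rewrite -natr1 in a2.
apply/andP; split.
  by rewrite -lerBrDl ler_pdivrMr.
by rewrite -ltrBlDl ltr_pdivlMr.
Qed.

Lemma sum_min_le (J N : nat) (t : R) : 0 <= t ->
  \sum_(l < J) (if (l < N)%N then t else 0) <= N%:R * t.
Proof.
move=> t0; suff -> : \sum_(l < J) (if (l < N)%N then t else 0) = (minn J N)%:R * t.
  by rewrite ler_wpM2r // ler_nat geq_minr.
elim: J => [|J IH]; first by rewrite big_ord0 min0n mul0r.
rewrite big_ord_recr /= IH; case: ifP => JN.
  by rewrite (minn_idPl _) 1?ltnW // (minn_idPl JN) -natr1 mulrDl mul1r.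
have NJ : (N <= J)%N by rewrite leqNgt JN.
by rewrite addr0 (minn_idPr NJ) (minn_idPr _) // leqW.
Qed.

Lemma sum_halves (J : nat) : \sum_(j < J) (2^-1 : R) ^+ j.+1 <= 1.
Proof.
suff -> : \sum_(j < J) (2^-1 : R) ^+ j.+1 = 1 - 2^-1 ^+ J.
  by rewrite gerBl exprn_ge0.
elim: J => [|J IH]; first by rewrite big_ord0 expr0 subrr.
by rewrite big_ord_recr /= IH exprS; lra.
Qed.

(* Enumerating pairs of natural numbers, a series with terms [a (j, l)] is
   bounded through its finite partial double sums. *)
Lemma nneseries_pair_le (d : nat -> \bar R) (a : nat -> nat -> R) (b : R) :
  (forall i, 0 <= d i)%E -> (forall j l, 0 <= a j l) ->
  (forall i, (d i <= (if (pickle_inv i : option (nat * nat)) is Some p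
                     then a p.1 p.2 else 0)%:E)%E) ->
  (forall J, \sum_(j < J) \sum_(l < J) a j l <= b) ->
  (\sum_(0 <= i <oo) d i <= b%:E)%E.
Proof.
move=> d0 a0 da ab; apply: lime_le; first exact: is_cvg_nneseries.
apply: nearW => B.
apply: (@le_trans _ _ (\sum_(0 <= i < B) (if (pickle_inv i : option (nat * nat))
     is Some p then a p.1 p.2 else 0)%:E)%E); first exact: lee_sum.
rewrite sumEFin lee_fin big_mkord.
(* [J] exceeds both components of every pair whose code is below [B]. *)
pose J := (\sum_(i < B) (if (pickle_inv i : option (nat * nat)) is Some p
                         then p.1 + p.2 else 0)).+1%N.
apply: le_trans (ab J).
pose ind i (p : nat * nat) : R := (pickle_inv i == Some p)%:R.
have -> : \sum_(i < B) (if (pickle_inv i : option (nat * nat)) is Some p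
     then a p.1 p.2 else 0) =
   \sum_(i < B) \sum_(j < J) \sum_(l < J) ind i (j : nat, l : nat) * a j l.
  apply: eq_bigr => i _; rewrite /ind; case E: (pickle_inv _) => [[j l]|]; last first.
    by rewrite big1 // => j _; rewrite big1 // => l _; rewrite mul0r.
  have : (j + l < J)%N.
    by rewrite ltnS (bigD1 i) //= E /= leq_addr.
  move=> jlJ; have jJ : (j < J)%N by lia. have lJ : (l < J)%N by lia.
  rewrite (bigD1 (Ordinal jJ)) //= (bigD1 (Ordinal lJ)) //= eqxx mul1r.
  rewrite big1 ?addr0 => [|l' ll']; last first.
    by case: eqP => [[e]|_]; rewrite ?mul0r //; case/eqP: ll'; apply: val_inj.
  rewrite big1 ?addr0 // => j' jj'; rewrite big1 // => l' _.
  by case: eqP => [[e _]|_]; rewrite ?mul0r //; case/eqP: jj'; apply: val_inj.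
rewrite exchange_big /=; apply: ler_sum => j _.
rewrite exchange_big /=; apply: ler_sum => l _.
rewrite -mulr_suml ler_piMl //.
have [jlB|Bjl] := ltnP (pickle (j : nat, l : nat)) B; last first.
  rewrite big1 // => i _; rewrite /ind; case: eqP => // ij.
  have := @pickle_invK (nat * nat)%type i; rewrite ij /= => e.
  by have := ltn_ord i; rewrite -e ltnNge Bjl.
rewrite (bigD1 (Ordinal jlB)) //= big1 ?addr0 /ind ?lern1 ?leq_b1 // => i ne.
case: eqP => // ij; have := @pickle_invK (nat * nat)%type i; rewrite ij /= => e.
by case/eqP: ne; apply: val_inj.
Qed.

Lemma exists_scale (c eta tau : R) (Q : nat) : 0 <= c -> 0 < eta -> 0 < tau ->
  exists2 q0, (Q <= q0)%N & forall q, (q0 <= q)%N -> c * q%:R `^ (- tau) <= eta.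
Proof.
move=> c0 eta0 tau0.
pose b := (c / eta) `^ tau^-1.
exists (maxn Q.+1 (Num.trunc b).+1); first by rewrite leq_max leqW.
move=> q; rewrite geq_max => /andP[Qq bq].
have q_gt0 : 0 < q%:R :> R by rewrite ltr0n; lia.
have bq' : b <= q%:R.
  have /andP[_ /ltW b1] := truncn_itv (powR_ge0 (c / eta) tau^-1).
  by apply: le_trans b1 _; rewrite ler_nat.
rewrite powRN ler_pdivrMr ?powR_gt0 // mulrC -ler_pdivrMr //.
have -> : c / eta = b `^ tau.
  by rewrite -powRrM mulVf ?gt_eqF // powRr1 // divr_ge0 // ltW.
by apply: ge0_ler_powR => //; rewrite ?nnegrE ?powR_ge0 ?ltW.
Qed.

(** Each unit cube gets its own scale, fine enough for its occupied cubes to contribute at most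
    [eta] times a term of a geometric series; hence good scales need only be arbitrarily fine, and
    may depend on [z]. *)
Lemma hausdorff_measure_eq0 E s (C tau : R) : 0 <= C -> 0 < tau ->
  (forall z Q, exists q, [/\ (Q <= q)%N, (0 < q)%N &
     #|occupied E z q|%:R <= C * q%:R ^+ s]) ->
  hausdorff_measure (s%:R + tau) E = 0%E.
Proof.
move=> C0 tau0 HE; set t := s%:R + tau.
have t0 : 0 <= t by rewrite addr_ge0 // ltW.
suff prem (delta : R) : 0 < delta -> hausdorff_premeasure t delta E = 0%E.
  apply/eqP; rewrite eq_le; apply/andP; split.
    by apply: ge_ereal_sup => _ [delta /= d0 <-]; rewrite prem.
  by apply: ereal_sup_ubound; exists 1; rewrite /= ?ltr01 // prem.
move=> d0; apply/eqP; rewrite eq_le; apply/andP; split; last first.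
  by apply: le_ereal_inf_tmp => _ [U _ <-]; apply: nneseries_ge0 => i _ _; exact: diam_pow_ge0.
apply/lee_addgt0Pr => eta eta0; rewrite add0e.
pose d := Num.sqrt n%:R : R.
have scale z : exists q, [/\ (0 < q)%N, d / q%:R <= delta &
    #|occupied E z q|%:R * (d / q%:R) `^ t <= eta * 2^-1 ^+ (pickle z).+1].
  have d_ge0 : 0 <= d by exact: sqrtr_ge0.
  have e0 : 0 < eta * 2^-1 ^+ (pickle z).+1 by rewrite mulr_gt0 ?exprn_gt0 ?invr_gt0.
  have [q1 _ H1] := @exists_scale d delta 1 0 d_ge0 d0 ltr01.
  have cd0 : 0 <= C * d `^ t by rewrite mulr_ge0 ?powR_ge0.
  have [q2 q12 H2] := @exists_scale (C * d `^ t) _ tau q1 cd0 e0 tau0.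
  have [q [q2q q_gt0 Hq]] := HE z q2.
  have q_gt0' : 0 < q%:R :> R by rewrite ltr0n.
  exists q; split => //.
    have := H1 q (leq_trans q12 q2q); rewrite powRN powRr1 //.
  apply: le_trans (H2 _ q2q); apply: le_trans (ler_wpM2r (powR_ge0 _ _) Hq) _.
  rewrite powRM ?invr_ge0 ?ler0n // -(powR_inv1 (ler0n R q)) -powRrM mulN1r.
  rewrite [X in X <= _]mulrACA.
  rewrite ler_wpM2l // -powR_mulrn ?ler0n // -powRD ?(gt_eqF q_gt0') ?implybT //.
  by rewrite (_ : s%:R - t = - tau) // /t; ring.
have {scale} [Q HQ] := choice scale.
pose W z (l : nat) : option {ffun 'I_n -> 'I_(Q z)} := onth (enum (occupied E z (Q z))) l.
(* The index [i] codes the pair of the code of [z] and the rank of an occupied cube; all other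
   indices give the empty set, which contributes 0. *)
pose U i : set 'rV[R]_n := if (pickle_inv i : option (nat * nat)) is Some p then
  if (pickle_inv p.1 : option {ffun 'I_n -> int}) is Some z then
  if W z p.2 is Some w then cube z (Q z) (fun i => w i) else set0 else set0 else set0.
pose a j l : R := if (pickle_inv j : option {ffun 'I_n -> int}) is Some z then
   if (l < #|occupied E z (Q z)|)%N then (d / (Q z)%:R) `^ t else 0 else 0.
apply: (@le_trans _ _ (\sum_(0 <= i <oo) diam_pow t (U i))%E).
  apply: ereal_inf_lbound; exists U => //; split.
    move=> e Ee; pose z : {ffun 'I_n -> int} := [ffun i => Num.floor (e ord0 i)].
    have [q_gt0 _ _] := HQ z.
    have [|w cw] := @cube_cover z (Q z) e q_gt0; first by move=> i; rewrite ffunE.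
    have wE : w \in enum (occupied E z (Q z)).
      by rewrite mem_enum inE; apply/asboolP; exists e.
    exists (pickle (pickle z, index w (enum (occupied E z (Q z))))) => //.
    rewrite /U !pickleK_inv /= /W.
    by rewrite onthE (nth_map w) ?index_mem // nth_index.
  move=> i; rewrite /U.
  have diam0 : (@diam R n set0 <= delta%:E)%E.
    by apply: ge_ereal_sup => _ [->|[[x y] [/= []]]]; rewrite lee_fin ltW.
  case: (pickle_inv i) => [[j l]|] //=; case: (pickle_inv j) => [z|] //.
  case: (W z l) => [w|] //; have [q_gt0 dq _] := HQ z.
  by apply: le_trans (diam_cube _ _ q_gt0) _; rewrite lee_fin.
have dp0 : diam_pow t (set0 : set 'rV[R]_n) = 0%E by rewrite /diam_pow eqxx.
apply: (@nneseries_pair_le _ a) => [i|j l|i|J].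
- exact: diam_pow_ge0.
- by rewrite /a; case: pickle_inv => // z; case: ifP => // _; exact: powR_ge0.
- rewrite /U /a; case: (pickle_inv i) => [[j l]|] /=; last by rewrite dp0.
  case: (pickle_inv j) => [z|]; last by rewrite dp0.
  have [q_gt0 _ _] := HQ z.
  case: ifP => lE; last first.
    by rewrite /W onth_default ?dp0 // -cardE leqNgt lE.
  case: (W z l) => [w|]; last by rewrite dp0 lee_fin powR_ge0.
  exact: diam_pow_cube.
apply: (@le_trans _ _ (eta * \sum_(j < J) 2^-1 ^+ j.+1)).
  rewrite mulr_sumr; apply: ler_sum => j _; rewrite /a.
  have := @pickle_invK {ffun 'I_n -> int} j; case: (pickle_inv _) => [z|] /= jz; last first.
    by rewrite big1 // mulr_ge0 ?exprn_ge0 ?invr_ge0 // ltW.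
  apply: le_trans (sum_min_le _ _ (powR_ge0 _ _)) _.
  by have [_ _] := HQ z; rewrite jz.
by rewrite ler_piMr ?sum_halves // ltW.
Qed.

Lemma hausdorff_dim_le E s (C : R) :
  (forall z Q, exists q, [/\ (Q <= q)%N, (0 < q)%N &
     #|occupied E z q|%:R <= C * q%:R ^+ s]) ->
  (hausdorff_dim E <= (s%:R : R)%:E)%E.
Proof.
move=> HE; have C0 : 0 <= `|C| by exact: normr_ge0.
apply/lee_addgt0Pr => tau tau0; rewrite -EFinD.
apply: ereal_inf_lbound; exists (s%:R + tau) => //=; split.
  by rewrite addr_ge0 // ltW.
apply: (hausdorff_measure_eq0 C0 tau0) => z Q.
have [q [Qq q0 qE]] := HE z Q; exists q; split => //.
by apply: le_trans qE _; rewrite ler_wpM2r ?exprn_ge0 // ler_norm.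
Qed.

End cover.

(** * Angles close to 0 and pi *)

Section extreme.
Context {R : realType} {n : nat}.
Implicit Types (E : set 'rV[R]_n) (x y z : 'rV[R]_n).

(* The sets of colours seen from below cannot all be distinct. *)
Lemma monochromatic_path (T : finType) (col : nat -> nat -> T) :
  exists i j k, [/\ (i < j)%N, (j < k)%N & col i j = col j k].
Proof.
pose S (j : nat) : {set T} := [set col i j | i : 'I_j]%SET.
have /injectivePn[j [k jk Sjk]] : ~~ injectiveb (fun j : 'I_#|{set T}|.+1 => S j).
  by apply/negP => /injectiveP /leq_card; rewrite card_ord ltnn.
wlog ltjk : j k jk Sjk / (j < k)%N => [hw|].
  by case: (ltngtP j k) => [|kj|/val_inj e]; [exact: hw|apply: (hw k j) => //; rewrite eq_sym|rewrite e eqxx in jk].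
have : col j k \in S k by apply/imsetP; exists (Ordinal ltjk).
rewrite -Sjk => /imsetP[i _ e]; exists i, j, k; split => //; exact: ltn_ord.
Qed.

Lemma coord_le_enorm x i : `|x ord0 i| <= enorm x.
Proof.
rewrite -ler_sqr ?nnegrE ?enorm_ge0 // real_normK ?num_real // enorm_sqr.
rewrite /dotv (bigD1 i) //= -expr2 lerDl; apply: sumr_ge0 => j _.
by rewrite -expr2 sqr_ge0.
Qed.

(** Pairs [i < j] are coloured by the grid cell of the direction from [f i] to [f j]; a
    monochromatic path has two consecutive, nearly equal directions. *)
Lemma near_straight_path E (c : R) : infinite_set E -> c < 1 ->
  exists x y z, [/\ E x, E y & E z] /\ [/\ x != y, y != z & x != z] /\
    c < vcos (y - x) (z - y).
Proof.
move=> /infiniteP/pcard_leP[f] c1.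
have fE i : E (f i) by exact: (@funS _ _ _ _ f).
have f_inj i j : f i = f j -> i = j by move=> e; apply: (@inj _ _ _ f); rewrite ?inE.
pose u i j : 'rV[R]_n := (enorm (f j - f i))^-1 *: (f j - f i).
have fneq i j : (i < j)%N -> f j - f i != 0.
  by move=> ij; rewrite subr_eq0; apply/eqP => /f_inj e; rewrite e ltnn in ij.
have u_unit i j : (i < j)%N -> enorm (u i j) = 1.
  by move=> ij; rewrite enormZ ger0_norm ?invr_ge0 ?enorm_ge0 // mulVf // gt_eqF // enorm_gt0 // fneq.
(* In a grid of mesh [1 / Q], unit vectors in a common cell are at squared distance at most
   [n / Q ^ 2], which is below [1 - c]. *)
pose Q := (Num.trunc (n%:R / (1 - c))).+1.
have Q_gt0 : 0 < Q%:R :> R by rewrite ltr0n.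
have Qc : n%:R < Q%:R * (1 - c).
  rewrite -ltr_pdivrMr ?subr_gt0 //.
  have c0 : 0 <= n%:R / (1 - c) by rewrite divr_ge0 // subr_ge0 ltW.
  by have /andP[_] := truncn_itv c0.
pose a i j (k : 'I_n) := Num.trunc ((u i j ord0 k + 1) * Q%:R).
have ab i j k : (i < j)%N -> (a i j k)%:R <= (u i j ord0 k + 1) * Q%:R < (a i j k).+1%:R.
  move=> ij; apply: truncn_itv; rewrite mulr_ge0 //.
  have := coord_le_enorm (u i j) k; rewrite u_unit // ler_norml => /andP[]; lra.
have a2 i j k : (i < j)%N -> (a i j k < (2 * Q).+1)%N.
  move=> ij; have /andP[a1 _] := ab i j k ij.
  rewrite ltnS -(ler_nat R); apply: le_trans a1 _; rewrite natrM ler_pM2r //.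
  have := coord_le_enorm (u i j) k; rewrite u_unit // ler_norml => /andP[]; lra.
have [i [j [k [ij jk]]]] := monochromatic_path
  (fun i j => [ffun k => inord (a i j k) : 'I_(2 * Q).+1]).
move=> /ffunP ejk; have {}ejk l : a i j l = a j k l.
  by have := congr1 (@nat_of_ord _) (ejk l); rewrite !ffunE !inordK ?a2.
exists (f i), (f j), (f k); split; first by split.
split.
  split; first by rewrite eq_sym -subr_eq0 fneq.
    by rewrite eq_sym -subr_eq0 fneq.
  by rewrite eq_sym -subr_eq0 fneq // (ltn_trans ij).
have uv : dotv (u i j - u j k) (u i j - u j k) <= n%:R / Q%:R ^+ 2.
  rewrite -enorm_sqr -[n%:R]sqr_sqrtr // -expr_div_n.
  have sQ : 0 <= Num.sqrt n%:R / Q%:R :> R by rewrite divr_ge0 ?sqrtr_ge0.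
  apply: lerXn2r; rewrite ?nnegrE ?enorm_ge0 //.
  apply: enorm_le => [|l]; first by rewrite invr_ge0 ltW.
  have -> : (u i j - u j k) ord0 l = u i j ord0 l - u j k ord0 l by rewrite !mxE.
  have := ab j k l jk; have := ab i j l ij; rewrite ejk -natr1.
  set A := _%:R; set X := u i j ord0 l; set Y := u j k ord0 l.
  move=> /andP[x1 x2] /andP[y1 y2].
  rewrite -(ler_pM2r Q_gt0) mulVf ?gt_eqF // -[X in _ * X]gtr0_norm // -normrM ler_norml.
  by apply/andP; split; lra.
have -> : vcos (f j - f i) (f k - f j) = dotv (u i j) (u j k).
  by rewrite dotvZl dotvZr /vcos invfM; ring.
move: uv; rewrite dotvDl !dotvDr !dotvNl !dotvNr (dotvC (u j k)) -!enorm_sqr !u_unit // expr1n => uv.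
have : n%:R / Q%:R ^+ 2 < 1 - c.
  rewrite ltr_pdivrMr ?exprn_gt0 //; apply: lt_le_trans Qc _.
  rewrite mulrC ler_wpM2l ?subr_ge0 ?(ltW c1) // expr2 ler_peMl ?(ltW Q_gt0) //.
  by rewrite ler1n.
lra.
Qed.

Lemma extreme_angles E (t : R) : infinite_set E -> 0 < t <= pi ->
  (exists x y z, [/\ E x, E y & E z] /\ [/\ x != y, y != z & x != z] /\
    angle x y z < t) /\
  (exists x y z, [/\ E x, E y & E z] /\ [/\ x != y, y != z & x != z] /\
    pi - t < angle x y z).
Proof.
move=> Einf /andP[t0 tpi].
have cost1 : cos t < 1.
  by rewrite -[X in _ < X](@cos0 R) ltr_cos // in_itv/= ?lexx ?pi_ge0 // (ltW t0) tpi.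
(* The path turns little at [y], so the angle at [y] is close to [pi] and the one at [x] close to 0.
   The bound 0 makes the cosine positive, as the angle at [x] requires. *)
have [|x [y [z [[Ex Ey Ez] [[xy yz xz] h]]]]] := @near_straight_path E (Num.max (cos t) 0) Einf.
  by rewrite gt_max cost1 ltr01.
have a0 : y - x != 0 by rewrite subr_eq0 eq_sym.
have b0 : z - y != 0 by rewrite subr_eq0 eq_sym.
have ab0 : z - x != 0 by rewrite subr_eq0 eq_sym.
have c0 : x - y != 0 by rewrite subr_eq0.
move: h; rewrite gt_max => /andP[h1 h2].
split.
  exists y, x, z; split; first by split.
  split; first by split; rewrite // eq_sym.
  rewrite angleE lt_vangle //; last by rewrite ltW.
  apply: lt_le_trans h1 _.
  have na := enorm_gt0 a0; have nab := enorm_gt0 ab0; have nb := enorm_gt0 b0.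
  have e : z - x = (y - x) + (z - y) by rewrite [RHS]addrC addrA subrK.
  rewrite [X in _ <= X]/vcos e dotvDr -e -enorm_sqr.
  have -> : dotv (y - x) (z - y) = vcos (y - x) (z - y) * (enorm (y - x) * enorm (z - y)).
    by rewrite divfK // mulf_neq0 ?gt_eqF.
  have := enormD (y - x) (z - y); rewrite -e.
  have /andP[_ v1] := vcos_itv a0 b0.
  set v := vcos _ _ in h2 v1 *; set A := enorm (y - x) in na *.
  set B := enorm (z - y) in nb *; set S := enorm (z - x) in nab * => le_S.
  rewrite ler_pdivlMr ?mulr_gt0 //.
  (* The cosine at [x] is [(A + v * B) / S], and [v * (A + B) <= A + v * B] as [v <= 1]. *)
  have : v * S <= v * (A + B) by rewrite ler_wpM2l // ltW.
  nra.
exists x, y, z; split; first by split.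
split; first by split.
rewrite angleE gt_vangle //; last by rewrite subr_ge0 tpi gerBl ltW.
rewrite -[x - y]opprB.
have -> : vcos (- (y - x)) (z - y) = - vcos (y - x) (z - y).
  by rewrite /vcos dotvNl enormN mulNr.
by rewrite cosB cospi sinpi mul0r addr0 mulN1r ltrN2.
Qed.

(** The points of a finite set occupy a number of cubes bounded independently of the scale. *)
Lemma infinite_of_dim E : (0 < hausdorff_dim E)%E -> infinite_set E.
Proof.
rewrite ltNge => /negP h /finite_seqP[s Es]; apply: h.
apply: (@hausdorff_dim_le R n E 0 (size s).+1%:R) => z Q.
exists Q.+1; split => //; rewrite expr0 mulr1 ler_nat.
have cub (w : {ffun 'I_n -> 'I_Q.+1}) : exists e, w \in occupied E z Q.+1 ->
    e \in s /\ cube z Q.+1 (fun i => w i) e.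
  have [|wE] := boolP (w \in occupied E z Q.+1); last by exists 0.
  by rewrite inE => /asboolP[e Ee ce]; exists e => _; split => //; rewrite Es in Ee.
have [h Hh] := choice cub.
pose g w : 'I_(size s).+1 := inord (index (h w) s).
suff g_inj : {in occupied E z Q.+1 &, injective g}.
  by rewrite -(card_in_imset g_inj) (leq_trans (max_card _)) // card_ord.
move=> w w' wE w'E /(congr1 (@nat_of_ord _)).
have [hs ch] := Hh w wE; have [hs' ch'] := Hh w' w'E.
rewrite !inordK ?ltnS ?index_size // => /(congr1 (nth 0 s)); rewrite !nth_index // => hh.
apply/ffunP => i; apply: val_inj => /=.
have /andP[l1 u1] := ch i; have /andP[l2 u2] := ch' i; rewrite -hh in l2 u2.
have q0 : 0 < (Q.+1%:R : R)^-1 by rewrite invr_gt0 ltr0n.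
have l12 := le_lt_trans l1 u2; have l21 := le_lt_trans l2 u1.
rewrite ltrD2l ltr_pM2r // in l12; rewrite ltrD2l ltr_pM2r // in l21.
move: l12 l21; rewrite !natr1 !ltr_nat !ltnS => a b.
by apply/eqP; rewrite eqn_leq a b.
Qed.

End extreme.

(** * Sets whose angles avoid the interval from pi / 3 to 2 pi / 3 *)

Section wide.
Context {R : realType} {n : nat}.
Implicit Types (E : set 'rV[R]_n) (x y z : 'rV[R]_n).

(** For distinct points: the angle at [y] lies outside the interval from [pi / 3] to [2 pi / 3]. *)
Definition wide_angle x y z : Prop := 2^-1 < `|vcos (x - y) (z - y)|.

(** The angle opposite a longest side is at least [pi / 3], so avoiding the interval forces it above
    [2 pi / 3]. *)
Lemma obtuse_opposite x y z : x != y -> z != y -> wide_angle x y z ->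
  dotv (x - y) (x - y) <= dotv (x - z) (x - z) ->
  dotv (y - z) (y - z) <= dotv (x - z) (x - z) ->
  vcos (x - y) (z - y) < - 2^-1.
Proof.
move=> xy zy wide h1 h2.
have a0 : 0 < enorm (x - y) by rewrite enorm_gt0 // subr_eq0.
have b0 : 0 < enorm (z - y) by rewrite enorm_gt0 // subr_eq0.
suff le2 : vcos (x - y) (z - y) <= 2^-1.
  by move: wide; rewrite /wide_angle ltr_normr => /orP[|]; [rewrite ltNge le2|rewrite ltrNr].
have e : x - z = (x - y) - (z - y) by rewrite opprB addrA subrK.
have h2' : dotv (z - y) (z - y) <= dotv (x - z) (x - z).
  by apply: le_trans h2; rewrite -(opprB z y) dotvNl dotvNr opprK.
rewrite e in h1 h2'; rewrite ler_pdivrMr ?mulr_gt0 //.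
move: {h2} h1 h2'; rewrite !(dotvBB (x - y) (z - y)) -!enorm_sqr.
set A := enorm (x - y) in a0 *; set B := enorm (z - y) in b0 *; set D := dotv _ _.
rewrite !expr2 => k1 k2; case: (lerP A B) => [AB|/ltW BA].
  by have := ler_wpM2l (ltW a0) AB; lra.
by have := ler_wpM2r (ltW b0) BA; lra.
Qed.

Lemma wide_triangle x y z : x != y -> z != y -> wide_angle x y z ->
  dotv (x - y) (x - y) <= dotv (x - z) (x - z) ->
  dotv (y - z) (y - z) <= dotv (x - z) (x - z) ->
  dotv (x - y) (x - y) + dotv (y - z) (y - z) + enorm (x - y) * enorm (y - z)
    < dotv (x - z) (x - z).
Proof.
move=> xy zy wide h1 h2; have := obtuse_opposite xy zy wide h1 h2.
have a0 : 0 < enorm (x - y) by rewrite enorm_gt0 // subr_eq0.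
have b0 : 0 < enorm (z - y) by rewrite enorm_gt0 // subr_eq0.
have e : x - z = (x - y) - (z - y) by rewrite opprB addrA subrK.
rewrite -(opprB z y) enormN dotvNl dotvNr opprK.
rewrite ltr_pdivrMr ?mulr_gt0 // e (dotvBB (x - y) (z - y)).
lra.
Qed.

(* If all four distances are controlled by [|p - q|], both [w] and [w'] lie in
   the cone of half-angle [pi / 3] around [q - p]. *)
Lemma wide_cone (p q w w' : 'rV[R]_n) : p != w -> q != w -> p != w' -> q != w' ->
  p != q -> wide_angle p w q -> wide_angle p w' q ->
  dotv (p - w) (p - w) <= dotv (p - q) (p - q) ->
  dotv (w - q) (w - q) <= dotv (p - q) (p - q) ->
  dotv (p - w') (p - w') <= dotv (p - q) (p - q) ->
  dotv (w' - q) (w' - q) <= dotv (p - q) (p - q) ->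
  - 2^-1 <= vcos (w - p) (w' - p).
Proof.
move=> pw qw pw' qw' pq wide wide' h1 h2 h1' h2'.
have cone v : p != v -> q != v -> wide_angle p v q ->
    dotv (p - v) (p - v) <= dotv (p - q) (p - q) ->
    dotv (v - q) (v - q) <= dotv (p - q) (p - q) -> 2^-1 <= vcos (v - p) (q - p).
  move=> pv qv wv k1 k2; have := wide_triangle pv qv wv k1 k2.
  have a0 : 0 < enorm (p - v) by rewrite enorm_gt0 // subr_eq0.
  have b0 : 0 < enorm (v - q) by rewrite enorm_gt0 // subr_eq0 eq_sym.
  have c0 : 0 < enorm (p - q) by rewrite enorm_gt0 // subr_eq0.
  have e : p - q = (p - v) + (v - q) by rewrite addrA subrK.
  have := enormD (p - v) (v - q); rewrite -e.
  rewrite -(opprB p v) -(opprB p q) /vcos dotvNl dotvNr opprK !enormN.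
  have -> : dotv (p - v) (p - q) = (dotv (p - v) (p - v) + dotv (p - q) (p - q)
      - dotv (v - q) (v - q)) / 2.
    have -> : v - q = (p - q) - (p - v) by rewrite opprB [RHS]addrC addrA subrK.
    exact: dotv_polar.
  rewrite -!enorm_sqr ler_pdivlMr ?mulr_gt0 //.
  set A := enorm (p - v) in a0 *; set B := enorm (v - q) in b0 *.
  set D := enorm (p - q) in c0 *; nra.
have := cone w pw qw wide h1 h2; have := cone w' pw' qw' wide' h1' h2'.
have [u uu] := @unit_vectors R n.
have a0 : w - p != 0 by rewrite subr_eq0 eq_sym.
have b0 : w' - p != 0 by rewrite subr_eq0 eq_sym.
have c0 : q - p != 0 by rewrite subr_eq0 eq_sym.
(* The two unit vectors each have inner product at least [1 / 2] with that of [q - p], so their sum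
   has norm at least 1. *)
have := cauchy_schwarz (u (w - p) + u (w' - p)) (u (q - p)).
rewrite !dotvDl !dotvDr !uu !vcosxx // (vcosC (w' - p) (w - p)).
set a := vcos (w - p) (q - p); set b := vcos (w' - p) (q - p); nra.
Qed.

(* Sorting the points by squared distance to an end [p] of a diameter [p q], the
   successive squared distances differ by at least [delta]. *)
Lemma wide_card (T : finType) (A : {set T}) (h : T -> 'rV[R]_n) (delta D : R) :
  0 < delta -> 0 <= D ->
  {in A &, forall w w', w != w' -> delta <= dotv (h w - h w') (h w - h w')} ->
  {in A &, forall w w', dotv (h w - h w') (h w - h w') <= D} ->
  {in A & &, forall a b c, a != b -> b != c -> a != c -> wide_angle (h a) (h b) (h c)} ->
  #|A|%:R <= D / delta + 1.
Proof.
move=> delta0 D0 sep bnd wide.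
pose d w w' := dotv (h w - h w') (h w - h w').
have dC w w' : d w w' = d w' w by rewrite /d -opprB dotvNl dotvNr opprK.
have hneq w w' : w \in A -> w' \in A -> w != w' -> h w != h w'.
  move=> wA w'A ww'; apply/eqP => e; have := sep _ _ wA w'A ww'.
  by rewrite e subrr -(scale0r 0) dotvZl mul0r leNgt delta0.
have [A1|A2] := leqP #|A| 1.
  have A1' : #|A|%:R <= 1 :> R by rewrite lern1.
  by apply: le_trans A1' _; rewrite lerDr divr_ge0 // ltW.
have /card_gt1P[a0 [b0 [a0A b0A ab0]]] := A2.
have [[p q] /= /andP[pA qA] pqmax] : exists2 ab : T * T, (ab.1 \in A) && (ab.2 \in A) &
    forall ab' : T * T, (ab'.1 \in A) && (ab'.2 \in A) -> d ab'.1 ab'.2 <= d ab.1 ab.2.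
  have P0 : ((a0, b0).1 \in A) && ((a0, b0).2 \in A) by rewrite a0A b0A.
  case: (@arg_maxP _ _ _ (a0, b0) (fun ab => (ab.1 \in A) && (ab.2 \in A)) (fun ab => d ab.1 ab.2) P0) => ab Pab Hab.
  by exists ab.
have dmax w w' : w \in A -> w' \in A -> d w w' <= d p q.
  by move=> wA w'A; apply: (pqmax (w, w')); rewrite wA w'A.
have pq : p != q.
  apply/eqP => e; have := dmax _ _ a0A b0A; rewrite leNgt /d -e subrr.
  by rewrite -(scale0r 0) dotvZl mul0r (lt_le_trans delta0) // sep.
have d0 w : d w w = 0 by rewrite /d subrr -(scale0r 0) dotvZl mul0r.
have gap w w' : w \in A -> w' \in A -> w != w' -> d p w <= d p w' -> d p w + delta <= d p w'.
  move=> wA w'A ww' le; have [ew|pw] := eqVneq p w.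
    by rewrite -ew d0 add0r; apply: sep => //; rewrite ew.
  have pw' : p != w'.
    apply/eqP => e; move: le; rewrite -e d0 leNgt.
    by rewrite (lt_le_trans delta0) // sep.
  (* If [p w'] is a longest side of the triangle, [wide_triangle] at [w] gives the gap. *)
  have [le2|lt2] := lerP (d w w') (d p w').
    have := wide_triangle (hneq _ _ pA wA pw) (hneq _ _ w'A wA _)
      (wide _ _ _ pA wA w'A pw ww' pw') le le2.
    have := sep _ _ wA w'A ww'.
    have : 0 <= enorm (h p - h w) * enorm (h w - h w') by rewrite mulr_ge0 ?enorm_ge0.
    rewrite eq_sym => e0 s0 /(_ ww'); rewrite -!/(d _ _); move: s0; rewrite -/(d _ _); lra.
  (* Otherwise [w w'] is the longest side, so the angle at [p] exceeds [2 pi / 3], against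
     [wide_cone]. *)
  exfalso.
  have w'q : w' != q.
    by apply/eqP => e; have := dmax _ _ wA w'A; rewrite leNgt -e lt2.
  have wq : w != q.
    apply/eqP => e; have := dmax _ _ wA w'A.
    by rewrite -e leNgt (le_lt_trans le lt2).
  have := @wide_cone (h p) (h q) (h w) (h w').
  rewrite !hneq // 1?[q == _]eq_sym // => /(_ isT isT isT isT isT).
  move=> /(_ (wide _ _ _ pA wA qA pw wq pq) (wide _ _ _ pA w'A qA pw' w'q pq)).
  rewrite -!/(d _ _) !dmax // => /(_ isT isT isT isT); apply/negP; rewrite -ltNge.
  apply: obtuse_opposite; rewrite ?hneq // 1?eq_sym //.
  - by apply: wide; rewrite // eq_sym.
  - by rewrite -!/(d _ _) dC (le_trans le) // ltW.
  - by rewrite -!/(d _ _) ltW.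
pose g w : 'I_(Num.trunc (D / delta)).+1 := inord (Num.trunc (d p w / delta)).
have dq0 w : 0 <= d p w / delta by rewrite divr_ge0 ?dotv_ge0 // ltW.
have g_inj : {in A &, injective g}.
  move=> w w' wA w'A; have [//|ww'] := eqVneq w w'.
  wlog le : w w' wA w'A ww' / d p w <= d p w' => [hw|].
    by case: (lerP (d p w) (d p w')) => [/hw|/ltW/hw]; [apply|rewrite eq_sym => H /esym /H ->].
  have trD v : v \in A -> (Num.trunc (d p v / delta) < (Num.trunc (D / delta)).+1)%N.
    by move=> vA; rewrite ltnS; apply: le_truncn; rewrite ler_pM2r ?invr_gt0 // bnd.
  move=> /(congr1 (@nat_of_ord _)); rewrite !inordK ?trD // => e; exfalso.
  have /andP[a1 a2] := truncn_itv (dq0 w); have /andP[b1 b2] := truncn_itv (dq0 w').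
  have := gap _ _ wA w'A ww' le; rewrite -(ler_pM2r (_ : 0 < delta^-1)) ?invr_gt0 // mulrDl divff ?gt_eqF //.
  by rewrite -e -natr1 in b2; lra.
rewrite -(card_in_imset g_inj); apply: (@le_trans _ _ (Num.trunc (D / delta)).+1%:R).
  by rewrite ler_nat (leq_trans (max_card _)) // card_ord.
rewrite -natr1 lerD2r; have [] := andP (@truncn_itv _ (D / delta) _) => //.
by rewrite divr_ge0 // ltW.
Qed.

End wide.

Section wide_dim.
Context {R : realType} {n : nat}.
Implicit Types (E : set 'rV[R]_n) (x y z : 'rV[R]_n).

Lemma coord_sqr_le (x : 'rV[R]_n) i : x ord0 i ^+ 2 <= dotv x x.
Proof.
rewrite -enorm_sqr -real_normK ?num_real // lerXn2r ?nnegrE ?enorm_ge0 //.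
exact: coord_le_enorm.
Qed.

Lemma cube_sub_unit (z : {ffun 'I_n -> int}) q (w : {ffun 'I_n -> 'I_q}) (x : 'rV[R]_n) i :
  cube z q (fun i => w i) x -> (z i)%:~R <= x ord0 i <= (z i)%:~R + 1.
Proof.
move=> /(_ i) /andP[l u].
have q0 : 0 < q%:R :> R by rewrite ltr0n (leq_ltn_trans _ (ltn_ord (w i))).
apply/andP; split; first by apply: le_trans l; rewrite lerDl divr_ge0.
apply: le_trans (ltW u) _; rewrite lerD2l ler_pdivrMr // mul1r natr1 ler_nat.
exact: ltn_ord.
Qed.

(* Cubes whose positions have the same parities are separated. *)
Lemma occupied_wide E (z : {ffun 'I_n -> int}) q : (0 < q)%N ->
  (forall x y w, E x -> E y -> E w -> x != y -> y != w -> x != w -> wide_angle x y w) ->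
  #|occupied E z q|%:R <= 2 ^+ n * (n%:R + 1) * q%:R ^+ 2 :> R.
Proof.
move=> q0 wide; have q0' : 0 < q%:R :> R by rewrite ltr0n.
have q1 : 1 <= q%:R :> R by rewrite ler1n.
have cub (w : {ffun 'I_n -> 'I_q}) : exists e, w \in occupied E z q ->
    E e /\ cube z q (fun i => w i) e.
  have [|wE] := boolP (w \in occupied E z q); last by exists 0.
  by rewrite inE => /asboolP[e Ee ce]; exists e => _; split.
have [h Hh] := choice cub.
pose parity (w : {ffun 'I_n -> 'I_q}) : {ffun 'I_n -> bool} := [ffun i => odd (w i)].
(* Distinct positions of equal parities differ by at least 2 in some coordinate, so chosen points
   are at least [1 / q] apart; [wide_card] then applies with [delta = q ^ -2] and [D = n]. *)
have class (p : {ffun 'I_n -> bool}) :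
    #|[set w in occupied E z q | parity w == p]%SET|%:R <= (n%:R + 1) * q%:R ^+ 2 :> R.
  have sep w w' : w \in occupied E z q -> w' \in occupied E z q ->
      parity w = parity w' -> w != w' -> q%:R ^- 2 <= dotv (h w - h w') (h w - h w').
    move=> wE w'E pw ww'; have [i wi] : exists i, w i != w' i.
      by apply/existsP; apply: contra_neqT ww' => /existsPn H; apply/ffunP => i; apply/eqP/negPn/H.
    apply: le_trans (coord_sqr_le _ i); rewrite !mxE.
    wlog lt : w w' wE w'E pw ww' wi / (w' i < w i)%N => [hw|].
      case: (ltngtP (w' i) (w i)) => [|lt|/val_inj e]; [exact: hw| |by rewrite e eqxx in wi].
      by rewrite -[X in _ <= X]sqrrN opprB; apply: hw => //; rewrite eq_sym.
    have lt2 : (w' i + 2 <= w i)%N.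
      have := congr1 (fun f : {ffun 'I_n -> bool} => f i) pw; rewrite !ffunE => od.
      rewrite addn2 ltn_neqAle lt andbT; apply/eqP => e.
      by rewrite -e /= in od; case: (odd _) od.
    have [_ /(_ i) /andP[l1 _]] := Hh w wE; have [_ /(_ i) /andP[_ u2]] := Hh w' w'E.
    have : q%:R^-1 <= h w ord0 i - h w' ord0 i.
      have : (w' i)%:R / q%:R + 2 / q%:R <= (w i)%:R / q%:R :> R.
        by rewrite -mulrDl ler_pM2r ?invr_gt0 // -natrD ler_nat.
      rewrite mulrDl in u2; lra.
    rewrite -exprVn => k; rewrite lerXn2r ?nnegrE ?invr_ge0 ?(ltW q0') //.
    by apply: le_trans k; rewrite invr_ge0 ltW.
  have := @wide_card R n _ [set w in occupied E z q | parity w == p]%SET h (q%:R ^- 2) n%:R.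
  rewrite invr_gt0 exprn_gt0 // ler0n invrK => /(_ isT isT) H.
  apply: (@le_trans _ _ (n%:R * q%:R ^+ 2 + 1)); last first.
    by rewrite mulrDl mul1r lerD2l exprn_ege1.
  apply: H => [w w'|w w'|a b c].
  - move=> /setIdP[wE /eqP pw] /setIdP[w'E /eqP pw'] ww'.
    by apply: sep => //; rewrite pw pw'.
  - move=> /setIdP[wE _] /setIdP[w'E _].
    rewrite -enorm_sqr -[n%:R]sqr_sqrtr // lerXn2r ?nnegrE ?enorm_ge0 ?sqrtr_ge0 //.
    rewrite -[X in _ <= X]mulr1; apply: enorm_le => // i; rewrite !mxE ler_norml.
    have [_ cw] := Hh w wE; have [_ cw'] := Hh w' w'E.
    have /andP[l1 u1] := cube_sub_unit i cw; have /andP[l2 u2] := cube_sub_unit i cw'.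
    by apply/andP; split; lra.
  move=> /setIdP[aE /eqP pa] /setIdP[bE /eqP pb] /setIdP[cE /eqP pc] ab bc ac.
  have neq w w' : w \in occupied E z q -> w' \in occupied E z q ->
      parity w = parity w' -> w != w' -> h w != h w'.
    move=> wE w'E pw ww'; apply/eqP => e; have := sep w w' wE w'E pw ww'.
    by rewrite e subrr -(scale0r 0) dotvZl mul0r leNgt invr_gt0 exprn_gt0.
  have [Ea _] := Hh a aE; have [Eb _] := Hh b bE; have [Ec _] := Hh c cE.
  by apply: wide => //; apply: neq => //; rewrite ?pa ?pb ?pc.
rewrite -sum1_card (partition_big parity xpredT) //= natr_sum.
apply: (@le_trans _ _ (\sum_(p : {ffun 'I_n -> bool}) (n%:R + 1) * q%:R ^+ 2)).
  apply: ler_sum => p _; rewrite sum1_card; apply: le_trans (class p).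
  by rewrite ler_nat; apply/eq_leq/eq_card => w; rewrite [RHS]finset.in_set.
by rewrite sumr_const -[_ *+ #|_|]mulr_natl card_ffun card_bool card_ord natrX mulrA.
Qed.

Lemma wide_dim_le E :
  (forall x y w, E x -> E y -> E w -> x != y -> y != w -> x != w -> wide_angle x y w) ->
  (hausdorff_dim E <= 2%:E)%E.
Proof.
move=> wide; apply: (@hausdorff_dim_le R n E 2 (2 ^+ n * (n%:R + 1))) => z Q.
by exists Q.+1; split => //; exact: occupied_wide.
Qed.

End wide_dim.

(** * Pairs of displacements whose difference returns to the set *)

Section growth.
Context {R : realType} {n : nat}.

(** The sumset of [F] and the discrete box of side [j], truncated to positions below [B]; nothing is
    lost when [q + j <= B]. *)
Definition fatten q B (F : {set {ffun 'I_n -> 'I_q}}) j : {set {ffun 'I_n -> 'I_B}} :=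
  [set v : {ffun 'I_n -> 'I_B} | [exists f in F, [forall i, (f i <= v i < f i + j)%N]]]%SET.

Lemma fattenP q B (F : {set {ffun 'I_n -> 'I_q}}) j (v : {ffun 'I_n -> 'I_B}) :
  reflect (exists2 f, f \in F & forall i, (f i <= v i < f i + j)%N) (v \in fatten B F j).
Proof.
rewrite inE; apply: (iffP exists_inP) => -[f fF].
  by move=> /forallP H; exists f.
by move=> H; exists f => //; apply/forallP.
Qed.

Lemma leq_card_fatten q B (F : {set {ffun 'I_n -> 'I_q}}) : (q <= B)%N ->
  (#|F| <= #|fatten B F 1|)%N.
Proof.
move=> qB; pose g (f : {ffun 'I_n -> 'I_q}) : {ffun 'I_n -> 'I_B} :=
  [ffun i => widen_ord qB (f i)].
have g_inj : injective g.
  move=> f f' /ffunP e; apply/ffunP => i; apply: val_inj.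
  by have := congr1 (@nat_of_ord _) (e i); rewrite !ffunE.
rewrite -(card_imset F g_inj); apply/subset_leq_card/fintype.subsetP => _ /imsetP[f fF ->].
by apply/fattenP; exists f => // i; rewrite ffunE /= leqnn addn1 ltnS leqnn.
Qed.

(* Otherwise the fattenings would outgrow the box of [(2 * M ^ K) ^ n] positions. *)
Lemma growth (E : set 'rV[R]_n) (c s M : nat) : (c + s)%N = n -> (1 < M)%N ->
  ((s%:R : R)%:E < hausdorff_dim E)%E ->
  exists z K k, [/\ (k < K)%N, (0 < #|occupied E z (M ^ K)|)%N &
    (#|fatten (2 * M ^ K) (occupied E z (M ^ K)) (M ^ k.+1)| <=
     M ^ c * #|fatten (2 * M ^ K) (occupied E z (M ^ K)) (M ^ k)|)%N].
Proof.
move=> cs M1; rewrite ltNge => /negP H; apply: contrapT => none; apply: H.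
have M0 : (0 < M)%N by lia.
apply: (@hausdorff_dim_le R n E s (2 ^+ n)) => z Q.
exists (M ^ Q)%N; split; [exact/ltnW/ltn_expl|by rewrite expn_gt0 M0|].
set F := occupied E z (M ^ Q).
have [->|F0] := posnP #|F|; first by rewrite mulr_ge0 ?exprn_ge0.
have step k : (k <= Q)%N -> (M ^ (c * k) * #|F| <= #|fatten (2 * M ^ Q) F (M ^ k)|)%N.
  elim: k => [_|k IH kQ].
    by rewrite muln0 expn0 mul1n leq_card_fatten // leq_pmull.
  rewrite mulnS expnD -mulnA; apply: leq_trans (leq_mul (leqnn _) (IH (ltnW kQ))) _.
  rewrite leqNgt; apply/negP => lt; apply: none.
  by exists z, Q, k; split => //; exact: ltnW.
have := leq_trans (step Q (leqnn _)) (max_card _).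
(* Cancelling the growth factor [M ^ (c * Q)] against the size of the box leaves the count that
   bounds the dimension by [s]. *)
have e : ((2 * M ^ Q) ^ n = M ^ (c * Q) * (2 ^ n * (M ^ Q) ^ s))%N.
  have -> : ((2 * M ^ Q) ^ n = 2 ^ n * (M ^ Q) ^ (c + s))%N by rewrite cs expnMn.
  by rewrite expnD mulnCA -[in RHS]expnM -expnM [(Q * c)%N]mulnC -expnM.
rewrite card_ffun !card_ord e leq_pmul2l ?expn_gt0 ?M0 //.
by rewrite -(ler_nat R) natrM !natrX.
Qed.

Lemma sum_sqr_le (T : finType) (D : {set T}) (g : T -> R) :
  (\sum_(s in D) g s) ^+ 2 <= #|D|%:R * \sum_(s in D) g s ^+ 2.
Proof.
set G := \sum_(s in D) g s; set N := #|D|%:R.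
have N0 : 0 <= N by rewrite ler0n.
have [D0|D_gt0] := posnP #|D|.
  rewrite /G big1 ?expr0n ?mulr_ge0 ?sumr_ge0 // => [s _|s sD]; first by rewrite sqr_ge0.
  by move: D0 => /cards0_eq D0; rewrite D0 inE in sD.
have : 0 <= \sum_(s in D) (N * g s - G) ^+ 2 by apply: sumr_ge0 => s _; rewrite sqr_ge0.
have -> : \sum_(s in D) (N * g s - G) ^+ 2 = N * (N * (\sum_(s in D) g s ^+ 2) - G ^+ 2).
  transitivity (\sum_(s in D) (N ^+ 2 * g s ^+ 2 - 2 * N * G * g s + G ^+ 2)).
    by apply: eq_bigr => s _; ring.
  rewrite !big_split /= sumrN -!mulr_sumr sumr_const -[_ *+ #|D|]mulr_natl -/G -/N; ring.
by rewrite pmulr_rge0 ?ltr0n // subr_ge0.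
Qed.

(** Cauchy-Schwarz over the fibres of [phi]: the double sum adds up the squared masses of the
    fibres. *)
Lemma collision (T S : finType) (P : {set T}) (D : {set S}) (phi : T -> S) (mu : T -> R) :
  (forall t, t \in P -> phi t \in D) ->
  (\sum_(t in P) mu t) ^+ 2 <= #|D|%:R *
    \sum_(t in P) \sum_(t' in P | phi t' == phi t) mu t * mu t'.
Proof.
move=> PD; pose g s := \sum_(t in P | phi t == s) mu t.
have -> : \sum_(t in P) mu t = \sum_(s in D) g s by exact: partition_big.
apply: le_trans (sum_sqr_le _ _) _; rewrite ler_wpM2l // le_eqVlt; apply/orP; left; apply/eqP.
rewrite (partition_big phi (mem D)) //=; apply: eq_bigr => s sD.
rewrite expr2 {1}/g mulr_suml; apply: eq_bigr => t /andP[tP /eqP <-].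
by rewrite mulr_sumr.
Qed.

(** The pairs [(u, u')] with [a + u - u'] in [A], written without subtraction of natural numbers. *)
Definition returns L B (A : {set {ffun 'I_n -> 'I_B}}) (a : {ffun 'I_n -> 'I_B}) :
    {set {ffun 'I_n -> cell L}} :=
  [set x : {ffun 'I_n -> cell L} | [exists a' in A,
     [forall i, (a i + (x i).1 == a' i + (x i).2)%N]]]%SET.

Definition pair_conf L (p : {ffun 'I_n -> 'I_L.+1} * {ffun 'I_n -> 'I_L.+1}) :
  {ffun 'I_n -> cell L} := [ffun i => (p.1 i, p.2 i)].

Lemma pair_conf_bij L : bijective (@pair_conf L).
Proof.
exists (fun x : {ffun 'I_n -> cell L} => ([ffun i => (x i).1], [ffun i => (x i).2])).
  by move=> [u v]; congr (_, _); apply/ffunP => i; rewrite !ffunE.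
by move=> x; apply/ffunP => i; rewrite !ffunE -surjective_pairing.
Qed.

(* [a] is found by counting, for random [a] in [A], the collisions
   [a + u = a' + u'] between two random displacements. *)
Lemma dense_center L B (A D : {set {ffun 'I_n -> 'I_B}}) : (1 < L)%N -> (0 < #|A|)%N ->
  (forall a (u : {ffun 'I_n -> 'I_L.+1}), a \in A ->
     exists2 v, v \in D & forall i, v i = (a i + u i)%N :> nat) ->
  exists2 a, a \in A & #|A|%:R <= #|D|%:R * conf_mass (returns L A a) :> R.
Proof.
move=> L1 A0 AD.
pose Om := {ffun 'I_n -> 'I_L.+1}.
pose mu (u : Om) : R := \prod_(i < n) bump_prob L (u i).
have mu0 u : 0 <= mu u by apply: prodr_ge0 => i _; exact: bump_prob_ge0.
have mu1 : \sum_u mu u = 1.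
  rewrite /mu -(bigA_distr_bigA (fun (i : 'I_n) (j : 'I_L.+1) => bump_prob L j)) /=.
  by rewrite big1 // => i _; exact: sum_bump_prob.
(* The default value of [insubd] never occurs for [t.1] in [A], where the sum fits below [B]. *)
pose phi (t : {ffun 'I_n -> 'I_B} * Om) : {ffun 'I_n -> 'I_B} :=
  [ffun i => insubd (t.1 i) (t.1 i + t.2 i)%N].
have phiE a u i : a \in A -> phi (a, u) i = (a i + u i)%N :> nat.
  move=> aA; have [v _ vE] := AD a u aA.
  by rewrite ffunE /= val_insubd -vE ltn_ord.
have sumP (H : {ffun 'I_n -> 'I_B} * Om -> R) :
    \sum_(t in finset.setX A [set: Om]%SET) H t = \sum_(a in A) \sum_(u : Om) H (a, u).
  rewrite pair_big_dep /=; apply: eq_big => [[a u]|[a u] _] //.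
  by rewrite finset.in_setX inE.
have sumQ (Q : pred ({ffun 'I_n -> 'I_B} * Om)) (H : {ffun 'I_n -> 'I_B} * Om -> R) :
    \sum_(t in finset.setX A [set: Om]%SET | Q t) H t =
    \sum_(a in A) \sum_(u : Om) (if Q (a, u) then H (a, u) else 0).
  by rewrite big_mkcondr sumP.
have massE a : conf_mass (returns L A a) = \sum_(u : Om) \sum_(u' : Om)
    (if [exists a' in A, [forall i, (a i + u i == a' i + u' i)%N]] then mu u * mu u' else 0) :> R.
  rewrite /conf_mass big_mkcond /= (reindex (@pair_conf L)) /=; last exact/onW_bij/pair_conf_bij.
  rewrite pair_bigA /=; apply: eq_bigr => -[u u'] _ /=.
  rewrite inE; set b := [exists _ in A, _]; set b' := [exists _ in A, _].
  have -> : b = b'.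
    apply: eq_existsb => a'; congr (_ && _); apply: eq_forallb => i; by rewrite ffunE.
  case: ifP => // _; rewrite /conf_prob -big_split; apply: eq_bigr => i _.
  by rewrite ffunE.
have := collision (P := finset.setX A [set: Om]%SET) (D := D) (phi := phi) (fun t => mu t.2).
rewrite sumP /= (eq_bigr (fun=> 1)) => [|a _]; last exact: mu1.
rewrite sumr_const sumP => H.
have {}H : #|A|%:R ^+ 2 <= #|D|%:R * \sum_(a in A) conf_mass (returns L A a) :> R.
  apply: le_trans (H _) _.
    move=> [a u]; rewrite finset.in_setX /= => /andP[aA _].
    have [v vD vE] := AD a u aA; suff -> : phi (a, u) = v by [].
    by apply/ffunP => i; apply: val_inj; rewrite /= phiE // vE.
  rewrite ler_wpM2l //; apply: ler_sum => a aA; rewrite massE; apply: ler_sum => u _.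
  rewrite sumQ /= exchange_big /=; apply: ler_sum => u' _.
  have eqphi a' : a' \in A -> phi (a', u') == phi (a, u) ->
      forall i, (a i + u i == a' i + u' i)%N.
    move=> a'A /eqP/ffunP e i; have := congr1 (@nat_of_ord _) (e i).
    by rewrite !phiE // => ->.
  (* Given [a], [u] and [u'], at most one [a'] collides, so counting collisions amounts to testing
     membership in [returns]. *)
  have uniqa a' a'' : a' \in A -> a'' \in A -> phi (a', u') == phi (a, u) ->
      phi (a'', u') == phi (a, u) -> a' = a''.
    move=> a'A a''A /eqphi e' /eqphi e''; apply/ffunP => i; apply: val_inj => /=.
    by apply: (@addIn (u' i)); rewrite -(eqP (e' a'A i)) -(eqP (e'' a''A i)).
  have [/existsP[a' /andP[a'A ph]]|/existsPn none] := boolP [exists a', (a' \in A) && (phi (a', u') == phi (a, u))].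
    rewrite (bigD1 a') //= ph big1 ?addr0 => [|a'' /andP[a''A ne]].
      case: ifP => // /existsP[]; exists a'; rewrite a'A /=.
      by apply/forallP; exact: eqphi.
    by case: ifP => // ph'; case/eqP: ne; exact: uniqa.
  rewrite big1 => [|a' a'A]; first by case: ifP => // _; rewrite mulr_ge0.
  by have := none a'; rewrite a'A /=; case: ifP.
(* Some [a] does at least as well as the average. *)
apply: contrapT => none.
have lt a : a \in A -> #|D|%:R * conf_mass (returns L A a) < #|A|%:R :> R.
  by move=> aA; rewrite ltNge; apply/negP => le; apply: none; exists a.
move: H; apply/negP; rewrite -ltNge mulr_sumr expr2 [X in _ < X]mulr_natl -[X in _ < X]sumr_const.
have [a0 a0A] : exists a0, a0 \in A by apply/set0Pn; rewrite -card_gt0.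
rewrite (bigD1 a0) //= [X in _ < X](bigD1 a0) //=.
by apply: ltr_leD; [exact: lt|apply: ler_sum => a /andP[aA _]; exact/ltW/lt].
Qed.

End growth.

(** * Sign changes *)

Section swap.
Context {R : realType}.

(** The first prefix sum to reach [T] exceeds its predecessor by at most [Y], so one of the two is
    within [Y / 2] of [T]. *)
Lemma balanced_prefix n (y : 'I_n -> R) (Y T : R) :
  0 <= Y -> (forall i, y i <= Y) -> 0 <= T <= \sum_i y i ->
  exists j, `|\sum_(i < n | (i < j)%N) y i - T| <= Y / 2.
Proof.
move=> Y0 yY /andP[T0 Ty]; pose P j := \sum_(i < n | (i < j)%N) y i.
have P0 : P 0%N = 0 by rewrite /P big_pred0.
have Pn : P n = \sum_i y i by rewrite /P; apply: eq_bigl => i; rewrite ltn_ord.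
have [|j Pj jmin] := @ex_minnP (fun j => T <= P j); first by exists n; rewrite Pn.
case: j Pj jmin => [|j] Pj jmin.
  by exists 0%N; rewrite -/(P 0%N) P0 in Pj *; rewrite ger0_norm; lra.
have ltP : P j < T by rewrite ltNge; apply/negP => /jmin; rewrite ltnn.
have Pstep : P j.+1 <= P j + Y.
  have [jn|nj] := ltnP j n; last first.
    rewrite (_ : P j.+1 = P j) ?lerDl //; apply: eq_bigl => i.
    by rewrite !(leq_trans (ltn_ord i)) // leqW.
  rewrite /P (bigD1 (Ordinal jn)) //= addrC lerD //.
  rewrite le_eqVlt; apply/orP; left; apply/eqP; apply: eq_bigl => i.
  by rewrite ltnS -val_eqE /= andbC -ltn_neqAle.
have [le|lt] := lerP (T - P j) (Y / 2).
  by exists j; rewrite -/(P j) distrC ger0_norm //; lra.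
by exists j.+1; rewrite -/(P j.+1) ger0_norm; lra.
Qed.

Definition gap_vector L n (x : {ffun 'I_n -> cell L}) : 'rV[R]_n :=
  \row_i cell_gap (x i).

Lemma centered_itv L i : (0 < L)%N -> (i <= L)%N -> `|centered L i| <= 1 :> R.
Proof.
move=> L0 iL; have l0 : 0 < L%:R :> R by rewrite ltr0n.
have i0 : 0 <= i%:R :> R by []. have il : i%:R <= L%:R :> R by rewrite ler_nat.
by rewrite /centered ler_norml ler_pdivlMr // ler_pdivrMr //; apply/andP; split; lra.
Qed.

Lemma cell_gap_sqr_le4 L (t : cell L) : (0 < L)%N -> cell_gap t ^+ 2 <= 4 :> R.
Proof.
move=> L0; have := @centered_itv L t.1 L0 (leq_ord t.1); have := @centered_itv L t.2 L0 (leq_ord t.2).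
rewrite /cell_gap !ler_norml => /andP[a b] /andP[c d]; nra.
Qed.

(** The term [8 / L ^ 2] undoes the two rounding losses in [cell_cost]; what remains is
    [(a - b) ^ 2 <= 2 * (a ^ 2 + b ^ 2)]. *)
Lemma gap_sub_sqr_le L (t t' : cell L) : (0 < L)%N ->
  (cell_gap t - cell_gap t') ^+ 2 <= 2 * (cell_cost t t' + 8 / L%:R ^+ 2) :> R.
Proof.
move=> L0; have l0 : L%:R != 0 :> R by rewrite pnatr_eq0; lia.
rewrite -subr_ge0 /cell_gap /cell_cost /centered.
set a := t.1%:R; set b := t.2%:R; set a' := t'.1%:R; set b' := t'.2%:R.
rewrite (_ : _ - _ = (2 * ((a - a') + (b - b')) / L%:R) ^+ 2); first exact: sqr_ge0.
by field.
Qed.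

(* Exchanging the two coordinates of a cell changes the sign of its gap, and the
   set of exchanged positions only depends on the absolute values of the gaps. *)
Lemma flipped_pair L n (A : {set {ffun 'I_n -> cell L}}) (b p : R) :
  (1 < L)%N -> 0 <= p <= 1 -> expR (- b) < conf_mass A ->
  exists x x' (f : 'rV[R]_n), [/\ x \in A, x' \in A,
    dotv f f = dotv (gap_vector x') (gap_vector x'),
    `|dotv f (gap_vector x') - (1 - 2 * p) * dotv (gap_vector x') (gap_vector x')| <= 4 &
    dotv (gap_vector x - f) (gap_vector x - f) <= 4 * b + 16 * n%:R / L%:R ^+ 2].
Proof.
move=> L1 p01 Ab; have L0 : (0 < L)%N by exact: ltnW.
pose sq (x : {ffun 'I_n -> cell L}) : {ffun 'I_n -> R} := [ffun i => cell_gap (x i) ^+ 2].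
(* Squared gaps are at most 4, so some prefix carries the share [p] of their sum up to an error 2;
   exchanging it changes the inner product by twice its sum. *)
have /choice[J HJ] : forall y : {ffun 'I_n -> R}, exists j,
    (forall i, 0 <= y i <= 4) ->
    `|\sum_(i < n | (i < j)%N) y i - p * \sum_i y i| <= 2.
  move=> y; have [y4|ny] := pselect (forall i, 0 <= y i <= 4); last by exists 0%N.
  have [||j Hj] := @balanced_prefix n y 4 (p * \sum_i y i) _ (fun i => proj2 (andP (y4 i))).
  - by [].
  - have s0 : 0 <= \sum_i y i by apply: sumr_ge0 => i _; case/andP: (y4 i).
    by case/andP: p01 => p0 p1; rewrite mulr_ge0 //= ler_piMl.
  by exists j => _; apply: le_trans Hj _; lra.
pose sw (x : {ffun 'I_n -> cell L}) : {ffun 'I_n -> cell L} :=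
  [ffun i : 'I_n => if (i < J (sq x))%N then ((x i).2, (x i).1) else x i].
have swE x i : sw x i = if (i < J (sq x))%N then ((x i).2, (x i).1) else x i.
  by rewrite ffunE.
have gap_sw x i : cell_gap (sw x i) =
    (if (i < J (sq x))%N then - cell_gap (x i) else cell_gap (x i)) :> R.
  by rewrite swE; case: ifP => // _; rewrite /cell_gap /= opprB.
have sq_sw x : sq (sw x) = sq x.
  by apply/ffunP => i; rewrite ffunE gap_sw [RHS]ffunE; case: ifP; rewrite ?sqrrN.
have swK : involutive sw.
  move=> x; apply/ffunP => i; rewrite (swE (sw x)) sq_sw !(swE x).
  case: ifP => h; case: ifP => h' //=; first by case: (x i).
    by have := etrans (esym h) h'.
  by have := etrans (esym h) h'.
have prob_sw x : conf_prob (sw x) = conf_prob x :> R.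
  apply: eq_bigr => i _; rewrite swE; case: ifP => // _.
  by rewrite /cell_prob mulrC.
pose B := (sw @: A)%SET.
have massB : conf_mass B = conf_mass A :> R.
  rewrite /conf_mass /B big_imset /=; last by move=> x y _ _; exact: (can_inj swK).
  by apply: eq_bigr => x _; exact: prob_sw.
(* Otherwise [conf_concentration], for [A] and its image [B] of equal mass, would bound the squared
   mass of [A] by [expR (- (2 * b))]. *)
have [x [x' [xA x'A lt]]] : exists x x', [/\ x \in A, x' \in A &
    \sum_(i < n) cell_cost (x i) (sw x' i) < 2 * b].
  apply: contrapT => none.
  have := @conf_concentration R L n A B (2 * b) L1; rewrite massB => H.
  have : conf_mass A * conf_mass A * expR (2 * b) <= 1 :> R.
    apply: H => x _ xA /imsetP[x' x'A ->]; rewrite leNgt; apply/negP => lt.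
    by apply: none; exists x, x'.
  apply/negP; rewrite -ltNge.
  have e1 : expR (- b) * expR (- b) * expR (2 * b) = 1.
    by rewrite -!expRD -[RHS]expR0; congr expR; ring.
  rewrite -[X in X < _]e1.
  by rewrite ltr_pM2r ?expR_gt0 //; apply: ltr_pM; rewrite ?expR_ge0.
exists x, x', (gap_vector (sw x')); split => //.
- by rewrite /dotv; apply: eq_bigr => i _; rewrite !mxE gap_sw; case: ifP; rewrite ?mulrNN.
- have sumE : dotv (gap_vector x') (gap_vector x') = \sum_i sq x' i.
    by apply: eq_bigr => i _; rewrite !mxE ffunE expr2.
  have -> : dotv (gap_vector (sw x')) (gap_vector x') =
      \sum_i sq x' i - 2 * \sum_(i < n | (i < J (sq x'))%N) sq x' i.
    rewrite [X in _ - 2 * X]big_mkcond mulr_sumr -sumrB; apply: eq_bigr => i _.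
    by rewrite !mxE gap_sw ffunE; case: ifP => _; ring.
  rewrite sumE; have := HJ (sq x'); set S := \sum_(i < n | _) _; set U := \sum_i _ => h.
  have {}h : `|S - p * U| <= 2.
    by apply: h => i; rewrite ffunE sqr_ge0 cell_gap_sqr_le4.
  rewrite (_ : _ - _ = - 2 * (S - p * U)); last by ring.
  move: h; rewrite !ler_norml => /andP[h1 h2].
  by apply/andP; split; lra.
apply: (@le_trans _ _ (\sum_i 2 * (cell_cost (x i) (sw x' i) + 8 / L%:R ^+ 2))).
  by apply: ler_sum => i _; rewrite !mxE -expr2 gap_sub_sqr_le.
rewrite -mulr_sumr big_split /= sumr_const card_ord -[_ *+ n]mulr_natl; lra.
Qed.

End swap.

(** * Stability of angles *)

Section numeric.
Context {R : realType}.

(** The bound [expR (1 / 16) <= 16 / 15] is squared four times to reach [expR 1]. It yields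
    [ln (8 / eps) >= 3] for [eps <= 1 / 3]. *)
Lemma expR3_le24 : expR 3 <= 24 :> R.
Proof.
have dbl (x a b : R) : expR x <= a -> a * a <= b -> expR (x + x) <= b.
  by move=> xa ab; rewrite expRD; apply: le_trans ab; rewrite ler_pM ?expR_ge0.
have e16 : expR (1 / 16) <= 16 / 15 :> R.
  have h := @expR_ge1Dx R (- (1 / 16)); have e := @expRxMexpNx_1 R (1 / 16).
  have := ler_wpM2l (@expR_ge0 R (1 / 16)) h; lra.
have e1 : expR 1 <= 2857 / 1000 :> R.
  have -> : expR 1 = expR (1 / 2 + 1 / 2) :> R by congr expR; field.
  apply: (dbl _ (169 / 100)); last by lra.
  rewrite (_ : 1 / 2 = 1 / 4 + 1 / 4 :> R); last by field.
  apply: (dbl _ (13 / 10)); last by lra.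
  rewrite (_ : 1 / 4 = 1 / 8 + 1 / 8 :> R); last by field.
  apply: (dbl _ (114 / 100)); last by lra.
  rewrite (_ : 1 / 8 = 1 / 16 + 1 / 16 :> R); last by field.
  by apply: dbl e16 _; lra.
have -> : expR 3 = expR 1 * expR 1 * expR 1 :> R.
  by rewrite -!expRD; congr expR; ring.
have e0 := @expR_ge0 R 1.
have e2 : expR 1 * expR 1 <= 82 / 10 :> R by apply: le_trans (ler_pM e0 e0 e1 e1) _; lra.
by apply: le_trans (ler_pM (mulr_ge0 e0 e0) e0 e2 e1) _; lra.
Qed.

Lemma sin_ge_sin (t s : R) : 0 <= t -> t <= s <= pi - t -> sin t <= sin s.
Proof.
move=> t0 /andP[ts st].
have mono u v : 0 <= u -> u <= v -> v <= pi / 2 -> sin u <= sin v :> R.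
  move=> u0 uv v2; rewrite leNgt ltr_sin ?in_itv/= -?leNgt //; apply/andP; split; lra.
have [s2|/ltW s2] := lerP s (pi / 2); first exact: mono.
have -> : sin s = sin (pi - s) by rewrite sinB sinpi cospi mul0r mulN1r opprK add0r.
by apply: mono; lra.
Qed.

Lemma cos_sub_cos (s d : R) : cos (s - d) - cos (s + d) = 2 * sin s * sin d.
Proof. by rewrite cosB cosD; ring. Qed.

(** With [d = 9 / 40 * eps], moving from [alpha] by [2 * d] changes the cosine by
    [2 * sin s * sin d], where [s] is the midpoint; [cos] being monotone, a larger deviation changes
    it even more. *)
Lemma angle_of_cos (eps alpha beta : R) : 0 < eps -> eps <= 1 / 3 ->
  pi * eps <= alpha -> alpha <= pi - pi * eps -> 0 <= beta <= pi ->
  `|cos beta - cos alpha| <= 93 / 100 * eps ^+ 2 ->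
  `|beta - alpha| <= 9 / 20 * eps.
Proof.
move=> eps0 eps3 lo up /andP[b0 bpi]; have := @pi_gt R => pi31.
have pe : 31 / 10 * eps <= pi * eps by rewrite ler_wpM2r ?ltW.
have e2 : eps ^+ 2 <= 1 / 9.
  by have := ler_pM (ltW eps0) (ltW eps0) eps3 eps3; rewrite expr2; lra.
have e3 : eps ^+ 3 <= 1 / 9 * eps by rewrite exprSr; apply: ler_wpM2r => //; exact: ltW.
(* As [pi > 31 / 10], [s] keeps distance [23 / 8 * eps] from 0 and [pi]; the cubic bounds give sines
   of at least [12 / 5 * eps] and [28 / 125 * eps]. *)
have gap s : pi * eps - 9 / 40 * eps <= s <= pi - (pi * eps - 9 / 40 * eps) ->
    93 / 100 * eps ^+ 2 < 2 * sin s * sin (9 / 40 * eps).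
  move=> /andP[s1 s2].
  have t0 : 0 <= 23 / 8 * eps by lra.
  have : sin (23 / 8 * eps) <= sin s by apply: sin_ge_sin => //; apply/andP; split; lra.
  have := sin_ge_cubic t0.
  have d0 : 0 <= 9 / 40 * eps by lra.
  have := sin_ge_cubic d0.
  set A := sin s; set B := sin (9 / 40 * eps); set C := sin (23 / 8 * eps).
  move=> hB hC hA.
  have hB' : 28 / 125 * eps <= B by rewrite exprMn in hB; lra.
  have hA' : 12 / 5 * eps <= A by rewrite exprMn in hC; lra.
  have : (12 / 5 * eps) * (28 / 125 * eps) <= A * B.
    by apply: ler_pM => //; lra.
  have : 0 < eps * eps by rewrite mulr_gt0.
  rewrite expr2; lra.
rewrite !ler_norml => /andP[c1 c2]; apply/andP; split; rewrite leNgt; apply/negP => h.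
  have := gap (alpha - 9 / 40 * eps); rewrite -cos_sub_cos subrK => /(_ _) H.
  have : cos (alpha - 9 / 40 * eps - 9 / 40 * eps) < cos beta.
    by rewrite ltr_cos ?in_itv/=; [|apply/andP; split|apply/andP; split]; lra.
  have : 93 / 100 * eps ^+ 2 < cos (alpha - 9 / 40 * eps - 9 / 40 * eps) - cos alpha.
    by apply: H; apply/andP; split; lra.
  lra.
have := gap (alpha + 9 / 40 * eps); rewrite -cos_sub_cos addrK => /(_ _) H.
have : cos beta < cos (alpha + 9 / 40 * eps + 9 / 40 * eps).
  by rewrite ltr_cos ?in_itv/=; [|apply/andP; split|apply/andP; split]; lra.
have : 93 / 100 * eps ^+ 2 < cos alpha - cos (alpha + 9 / 40 * eps + 9 / 40 * eps).
  by apply: H; apply/andP; split; lra.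
lra.
Qed.

End numeric.

(** * From the codimension and returning displacements to points of the set *)

Section approximation.
Context {R : realType} {n : nat}.

Lemma hausdorff_dim_le_ambient (E : set 'rV[R]_n) : (hausdorff_dim E <= (n%:R : R)%:E)%E.
Proof.
apply: (@hausdorff_dim_le R n E n 1) => z Q; exists Q.+1; split => //.
rewrite mul1r -natrX ler_nat (leq_trans (max_card _)) //.
by rewrite card_ffun !card_ord.
Qed.

(** The first bound combines [c >= 1] with [ln (8 / eps) >= 3]. For the second, [8 / eps >= 16]
    makes [32 / eps] at most the power [3 / 2] of [8 / eps]. *)
Lemma codimension_rate (eps : R) (c : nat) : 0 < eps -> eps <= 1 / 3 -> (0 < c)%N ->
  c%:R < eps ^+ 2 / (8 * ln (8 / eps)) * n%:R ->
  24 < n%:R * eps ^+ 2 /\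
  (Num.trunc (32 / eps))%:R ^+ c < expR (3 / 16 * (n%:R * eps ^+ 2)) :> R.
Proof.
move=> eps0 eps3 c0 ceps.
have e24 : 24 <= 8 / eps by rewrite ler_pdivlMr //; lra.
have e8 : 0 < 8 / eps by rewrite divr_gt0.
have ln3 : 3 <= ln (8 / eps).
  rewrite -[X in X <= _]expRK ler_ln ?posrE ?expR_gt0 //.
  by apply: le_trans e24; exact: expR3_le24.
set l := ln (8 / eps) in ceps ln3 *.
have cl : c%:R * (8 * l) < n%:R * eps ^+ 2.
  by move: ceps; rewrite mulrAC ltr_pdivlMr ?[n%:R * _]mulrC //; lra.
have c1 : 1 <= c%:R :> R by rewrite ler1n.
split.
  apply: le_lt_trans cl; have := ler_wpM2r (_ : 0 <= 8 * l) c1; rewrite mul1r => h.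
  by apply: le_trans (h _); lra.
have M0 : 0 < 32 / eps by rewrite divr_gt0.
have /andP[M1 _] := truncn_itv (ltW M0).
apply: (@le_lt_trans _ _ ((32 / eps) ^+ c)); first by rewrite lerXn2r ?nnegrE // ltW.
have lnX k u : 0 < u -> ln (u ^+ k) = k%:R * ln u :> R.
  by move=> u0; rewrite lnXn // mulr_natl.
have lnM : 2 * ln (32 / eps) <= 3 * l.
  rewrite /l -!lnX // ler_ln ?posrE ?exprn_gt0 //.
  rewrite (_ : 32 / eps = 4 * (8 / eps)); last by field; rewrite gt_eqF.
  set k := 8 / eps in e24 e8 *; rewrite -subr_ge0 (_ : _ - _ = k * k * (k - 16)); last by ring.
  by rewrite mulr_ge0 // ?subr_ge0; [rewrite mulr_ge0 // ltW|lra].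
rewrite -[X in X < _]lnK ?posrE ?exprn_gt0 // ltr_expR lnX //.
have : c%:R * (2 * ln (32 / eps)) <= c%:R * (3 * l) by rewrite ler_wpM2l.
lra.
Qed.

(* [e] witnesses that [a + x.1 - x.2] belongs to the fattening of the occupied cubes. *)
Lemma returns_point (E : set 'rV[R]_n) z q B j L (a : {ffun 'I_n -> 'I_B})
    (x : {ffun 'I_n -> cell L}) (y : 'rV[R]_n) : (0 < q)%N -> (0 < L)%N ->
  (exists2 f, cube z q (fun i => f i) y & forall i, (f i <= a i < f i + j)%N) ->
  x \in returns L (fatten B (occupied E z q) j) a ->
  exists2 e, E e & forall i,
    `|((2 * q%:R / L%:R) *: (e - y) - gap_vector x) ord0 i| <= 2 * j%:R / L%:R.
Proof.
move=> q0 L0 [f0 cy af0]; rewrite inE => /existsP[a' /andP[/fattenP[f fF af] /forallP eqx]].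
move: fF; rewrite inE => /asboolP[e Ee ce]; exists e => // i.
have q0' : 0 < q%:R :> R by rewrite ltr0n. have L0' : 0 < L%:R :> R by rewrite ltr0n.
rewrite !mxE /cell_gap /centered.
have /eqP := eqx i; have /andP[b1 b2] := af i; have /andP[b3 b4] := af0 i => ex.
have {}ex : (a i)%:R + (x i).1%:R = (a' i)%:R + (x i).2%:R :> R by rewrite -!natrD ex.
have {}b1 : (f i)%:R <= (a' i)%:R :> R by rewrite ler_nat.
have {}b2 : (a' i)%:R + 1 <= (f i)%:R + j%:R :> R by rewrite natr1 -natrD ler_nat.
have {}b3 : (f0 i)%:R <= (a i)%:R :> R by rewrite ler_nat.
have {}b4 : (a i)%:R + 1 <= (f0 i)%:R + j%:R :> R by rewrite natr1 -natrD ler_nat.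
have /andP[d1 d2] := ce i; have /andP[d3 d4] := cy i.
have k1 : (f i)%:R <= (e ord0 i - (z i)%:~R) * q%:R by rewrite -ler_pdivrMr // lerBrDl.
have k2 : (e ord0 i - (z i)%:~R) * q%:R < (f i)%:R + 1 by rewrite -ltr_pdivlMr // ltrBlDl.
have k3 : (f0 i)%:R <= (y ord0 i - (z i)%:~R) * q%:R by rewrite -ler_pdivrMr // lerBrDl.
have k4 : (y ord0 i - (z i)%:~R) * q%:R < (f0 i)%:R + 1 by rewrite -ltr_pdivlMr // ltrBlDl.
rewrite (_ : _ - _ = 2 * ((e ord0 i - (z i)%:~R) * q%:R - (y ord0 i - (z i)%:~R) * q%:R
  - ((x i).1%:R - (x i).2%:R)) / L%:R); last by field; rewrite gt_eqF.
rewrite normrM normfV [`|L%:R|]gtr0_norm // ler_pM2r ?invr_gt0 //.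
by rewrite ler_norml; apply/andP; split; lra.
Qed.

End approximation.

(** * Accumulated angular error *)

Section perturbation.
Context {R : realType} {n : nat}.
Implicit Types (v w f : 'rV[R]_n).

(** In units of the square root of [n], [v] has norm at least [21 / 50] and [w] at least
    [119 / 300], while their distance is at most [8 / 125 * eps]. *)
Lemma perturb_small (eps : R) v w : (0 < n)%N -> 0 < eps -> eps <= 1 / 3 ->
  18 / 100 * n%:R <= dotv v v -> dotv (w - v) (w - v) <= (8 / 125 * eps) ^+ 2 * n%:R ->
  [/\ v != 0, w != 0 & vangle w v <= 4 / 25 * eps].
Proof.
move=> n0 eps0 eps3 hv hw.
pose S := Num.sqrt n%:R : R.
have SS : S ^+ 2 = n%:R by rewrite sqr_sqrtr.
have S0 : 0 < S by rewrite sqrtr_gt0 ltr0n.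
have sq0 : 0 < S * S by rewrite mulr_gt0.
have nv : 21 / 50 * S <= enorm v.
  rewrite -ler_sqr ?nnegrE ?enorm_ge0 //; last by rewrite mulr_ge0 // ltW.
  rewrite enorm_sqr; apply: le_trans hv; rewrite -SS exprMn expr2; lra.
have nd : enorm (w - v) <= 8 / 125 * eps * S.
  have eS : 0 <= 8 / 125 * eps * S by rewrite !mulr_ge0 // ltW.
  by rewrite -ler_sqr ?nnegrE ?enorm_ge0 // enorm_sqr exprMn SS.
have epsS : eps * S <= 1 / 3 * S by rewrite ler_wpM2r // ltW.
have nw : 119 / 300 * S <= enorm w.
  have := enormD w (v - w); rewrite addrC subrK -[v - w]opprB enormN; lra.
have nz u : 0 < enorm u -> u != 0.
  move=> u0; apply: contraTneq u0 => ->; rewrite -leNgt /enorm /dotv.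
  by rewrite big1 ?sqrtr0 // => i _; rewrite mxE mul0r.
have v0 : v != 0 by apply: nz; apply: lt_le_trans nv; lra.
have w0 : w != 0 by apply: nz; apply: lt_le_trans nw; lra.
split => //; apply: vangle_le_small => //; first by apply/andP; split; lra.
apply: le_trans hw _.
have vw : (119 / 300 * S) * (21 / 50 * S) <= enorm w * enorm v.
  by apply: ler_pM nw nv; lra.
have e2 : eps * eps <= 1 / 9 by have := ler_pM (ltW eps0) (ltW eps0) eps3 eps3; lra.
have e20 : 0 < eps * eps by rewrite mulr_gt0.
set P := enorm w * enorm v in vw *.
have P0 : 0 < P by rewrite mulr_gt0 ?enorm_gt0.
have : 99 / 100 * P <= (1 - (4 / 25 * eps) ^+ 2 / 12) * P.
  by rewrite ler_pM2r // exprMn !expr2; lra.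
move=> h; rewrite -mulrA -SS !exprMn expr2 [eps ^+ 2]expr2 [S ^+ 2]expr2.
have h2 : 1 / 25 * 4 * (S * S) <= 99 / 100 * P by lra.
have : eps * eps * (1 / 25 * 4 * (S * S)) <= eps * eps * ((1 - (4 / 25 * eps) ^+ 2 / 12) * P).
  by rewrite ler_pM2l //; exact: le_trans h2 h.
rewrite exprMn !expr2; lra.
Qed.

(** The triangle inequality for angles along [w], [v], [f], [v'], [w']: the errors [4 / 25],
    [23 / 10], [9 / 20] and [4 / 25] add up to [307 / 100], just below [pi]. *)
Lemma angle_perturbation (eps alpha : R) v v' f w w' :
  0 < eps -> eps <= 1 / 3 -> 24 < n%:R * eps ^+ 2 ->
  pi * eps <= alpha -> alpha <= pi - pi * eps ->
  18 / 100 * n%:R <= dotv v v -> 18 / 100 * n%:R <= dotv v' v' ->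
  dotv f f = dotv v' v' ->
  `|dotv f v' - cos alpha * dotv v' v'| <= 4 ->
  dotv (v - f) (v - f) <= 9 / 10 * (n%:R * eps ^+ 2) ->
  dotv (w - v) (w - v) <= (8 / 125 * eps) ^+ 2 * n%:R ->
  dotv (w' - v') (w' - v') <= (8 / 125 * eps) ^+ 2 * n%:R ->
  [/\ w != 0, w' != 0 & `|vangle w w' - alpha| <= 307 / 100 * eps].
Proof.
move=> eps0 eps3 neps lo up hv hv' ff hcos hf hw hw'.
have n0 : (0 < n)%N.
  by move: neps; case: (n) => // ; rewrite mul0r => h; lra.
have nR : 0 < n%:R :> R by rewrite ltr0n.
have [v0 w0 a1] := perturb_small n0 eps0 eps3 hv hw.
have [v'0 w'0 a2] := perturb_small n0 eps0 eps3 hv' hw'.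
have f0 : f != 0 by rewrite -dotv_eq0 ff dotv_eq0.
have e2 : eps ^+ 2 <= 1 / 9.
  by have := ler_pM (ltW eps0) (ltW eps0) eps3 eps3; rewrite expr2; lra.
have eps20 : 0 < eps ^+ 2 by rewrite exprn_gt0.
have a3 : vangle v f <= 23 / 10 * eps.
  apply: vangle_le_small => //; first by apply/andP; split; lra.
  apply: le_trans hf _.
  have vf : 18 / 100 * n%:R <= enorm v * enorm f.
    rewrite -[X in X <= _]ger0_norm ?mulr_ge0 // -sqrtr_sqr /enorm -sqrtrM ?dotv_ge0 //.
    by apply: ler_wsqrtr; rewrite expr2 ff ler_pM // mulr_ge0.
  have k : 95 / 100 <= 1 - (23 / 10 * eps) ^+ 2 / 12 by rewrite exprMn expr2; lra.
  have : 95 / 100 * (18 / 100 * n%:R) <= (1 - (23 / 10 * eps) ^+ 2 / 12) * (enorm v * enorm f).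
    by apply: ler_pM k vf; lra.
  rewrite -[X in _ -> _ <= X]mulrA; set KP := (1 - _) * _ => h.
  have := ler_wpM2l (ltW eps20) h.
  rewrite [(23 / 10 * eps) ^+ 2]exprMn; lra.
have a4 : `|vangle f v' - alpha| <= 9 / 20 * eps.
  have v2 : 0 < dotv v' v' by rewrite dotv_gt0.
  apply: angle_of_cos => //; first exact: vangle_itv.
  rewrite cos_vangle //.
  have -> : vcos f v' = dotv f v' / dotv v' v'.
    by rewrite /vcos {1}/enorm ff -/(enorm v') -expr2 enorm_sqr.
  have -> : dotv f v' / dotv v' v' - cos alpha = (dotv f v' - cos alpha * dotv v' v') / dotv v' v'.
    by field; rewrite gt_eqF.
  rewrite normrM normfV [`|dotv v' v'|]gtr0_norm // ler_pdivrMr //.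
  apply: le_trans hcos _.
  (* The error 4 is absorbed since [n * eps ^ 2 > 24] and [93 / 100 * 18 / 100 * 24 > 4]. *)
  have : 93 / 100 * eps ^+ 2 * (18 / 100 * n%:R) <= 93 / 100 * eps ^+ 2 * dotv v' v'.
    by rewrite ler_wpM2l // mulr_ge0 // ltW.
  lra.
have t1 := vangle_triangle w0 v0 w'0; have t2 := vangle_triangle v0 f0 w'0.
have t3 := vangle_triangle f0 v'0 w'0.
have u1 := vangle_triangle f0 v0 v'0; have u2 := vangle_triangle v0 w0 v'0.
have u3 := vangle_triangle w0 w'0 v'0.
rewrite (vangleC f v) in u1; rewrite (vangleC v w) in u2; rewrite (vangleC v' w') in t3.
split => //; move: a4; rewrite !ler_norml => /andP[b1 b2]; apply/andP; split; lra.
Qed.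

End perturbation.

(** * Angles in sets of small codimension *)

Section final.
Context {R : realType} {n : nat}.

(** The scale found by [growth] is fed to [dense_center]: displacements up to [(M - 1) * m] carry
    the fattening of width [m] into that of width [M * m]. *)
Lemma dense_box (E : set 'rV[R]_n) (c s M : nat) : (c + s)%N = n -> (1 < M)%N ->
  ((s%:R : R)%:E < hausdorff_dim E)%E ->
  exists z q B m (a : {ffun 'I_n -> 'I_B}), [/\ (0 < q)%N, (0 < m)%N,
    a \in fatten B (occupied E z q) m &
    (2 < M)%N -> 1 <= M%:R ^+ c *
      conf_mass (returns ((M - 1) * m)%N (fatten B (occupied E z q) m) a) :> R].
Proof.
move=> cs M1 dimE; have M0 : (0 < M)%N by exact: ltnW.
have [z [K [k [kK F0]]]] := growth cs M1 dimE.
set q := (M ^ K)%N; set B := (2 * q)%N; set F := occupied E z q in F0 *.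
rewrite expnS; set m := (M ^ k)%N => grow.
have q_gt0 : (0 < q)%N by rewrite expn_gt0 M0.
have m_gt0 : (0 < m)%N by rewrite expn_gt0 M0.
have Mmq : (M * m <= q)%N by rewrite -expnS leq_exp2l.
have Lm : ((M - 1) * m + m = M * m)%N by rewrite mulnBl mul1n subnK // leq_pmull.
have qB : (q <= B)%N by rewrite leq_pmull.
have [f0 f0F] : exists f0, f0 \in F by apply/set0Pn; rewrite -card_gt0.
have A0 : (0 < #|fatten B F m|)%N.
  apply/card_gt0P; exists [ffun i => widen_ord qB (f0 i)]; apply/fattenP; exists f0 => // i.
  by rewrite ffunE /= leqnn -[X in (X < _)%N]addn0 ltn_add2l.
exists z, q, B, m.
(* For [M = 2] and [m = 1] the side would be 1, where [bump] vanishes identically; no mass is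
   claimed then. *)
have [M2|M2] := leqP M 2.
  have /card_gt0P[a aA] := A0; exists a; split => //.
have L1 : (1 < (M - 1) * m)%N.
  by apply: leq_trans (leq_pmulr _ m_gt0); rewrite ltn_subRL.
have [|a aA dense] := @dense_center R n _ B (fatten B F m) (fatten B F (M * m)) L1 A0.
  move=> a u /fattenP[f fF fa].
  have lo i : (f i <= a i + u i)%N by case/andP: (fa i) => h _; exact: leq_trans h (leq_addr _ _).
  have up i : (a i + u i < f i + M * m)%N.
    case/andP: (fa i) => _ h; rewrite -Lm [((M - 1) * m + m)%N]addnC addnA.
    by rewrite -addSn leq_add // -ltnS.
  have bd i : (a i + u i < B)%N.
    apply: leq_trans (up i) _; rewrite /B mul2n -addnn leq_add //.
    exact/ltnW/ltn_ord.
  exists [ffun i => Ordinal (bd i)]; last by move=> i; rewrite ffunE.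
  by apply/fattenP; exists f => // i; rewrite ffunE /= lo up.
exists a; split => // _.
have A0' : 0 < #|fatten B F m|%:R :> R by rewrite ltr0n.
rewrite -(ler_pM2l A0') mulr1; apply: le_trans dense _.
rewrite mulrCA mulrA ler_wpM2r //.
  by apply: sumr_ge0 => x _; exact: conf_prob_ge0.
by rewrite -natrX -natrM ler_nat.
Qed.

Lemma dense_box_angle (E : set 'rV[R]_n) (eps alpha : R) (c s : nat) :
  0 < eps -> eps <= 1 / 3 -> pi * eps <= alpha -> alpha <= pi - pi * eps ->
  (c + s)%N = n -> (0 < c)%N -> c%:R < eps ^+ 2 / (8 * ln (8 / eps)) * n%:R ->
  ((s%:R : R)%:E < hausdorff_dim E)%E ->
  exists x y z : 'rV[R]_n, [/\ E x, E y & E z] /\ [/\ x != y, y != z & x != z] /\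
    alpha - pi * eps < angle x y z < alpha + pi * eps.
Proof.
move=> eps0 eps3 lo up cs c0 ceps dimE.
have [neps Mc] := codimension_rate eps0 eps3 c0 ceps.
(* Large enough for the lattice error [2 / (M - 1)] to be at most [8 / 125 * eps]. *)
set M := Num.trunc (32 / eps) in Mc.
have M0' : 0 <= 32 / eps by rewrite divr_ge0 // ltW.
have Meps : 32 < (M%:R + 1) * eps.
  by have /andP[_ h] := truncn_itv M0'; rewrite -ltr_pdivrMr // natr1.
clearbody M.
have M31 : 94 / 3 <= (M%:R - 1) * eps.
  by lra.
have M94 : 94 <= M%:R - 1 :> R.
  have : (M%:R - 1) * eps <= (M%:R - 1) * (1 / 3).
    rewrite ler_wpM2l //; rewrite leNgt; apply/negP => neg.
    have : (M%:R - 1) * eps < 0 by rewrite nmulr_rlt0.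
    lra.
  lra.
have M95 : (95 <= M)%N by rewrite -(ler_nat R); lra.
have M1 : (1 < M)%N by exact: leq_trans M95.
have [z [q [B [m [a [q_gt0 m_gt0 aA]]]]]] := dense_box cs M1 dimE.
move=> /(_ (leq_trans (isT : (2 < 95)%N) M95)).
set L := ((M - 1) * m)%N; set A := fatten B (occupied E z q) m in aA *.
move=> dense.
have L94 : (94 <= L)%N.
  by apply: leq_trans (leq_pmulr _ m_gt0); rewrite leq_subRL ?(ltnW M1) //.
have L1 : (1 < L)%N by exact: leq_trans L94.
have massA : expR (- (3 / 16 * (n%:R * eps ^+ 2))) < conf_mass (returns L A a).
  have cm0 : 0 <= conf_mass (returns L A a) :> R.
    by apply: sumr_ge0 => x _; exact: conf_prob_ge0.
  have e0 := @expR_gt0 R (3 / 16 * (n%:R * eps ^+ 2)).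
  rewrite expRN -div1r ltr_pdivrMr // mulrC.
  apply: (le_lt_trans dense); rewrite ltr_pM2r //.
  rewrite ltNge; apply/negP => le0.
  by have := le_trans dense (mulr_ge0_le0 (exprn_ge0 c (ler0n R M)) le0); rewrite ler10.
(* Short gap vectors are discarded, as their directions are unstable. *)
pose G := (returns L A a :\: [set x : {ffun 'I_n -> cell L} |
    (\sum_(i < n) cell_gap (x i) ^+ 2 < 18 / 100 * n%:R :> R)%R])%SET.
have eps29 : eps ^+ 2 <= 1 / 9.
  by have := ler_pM (ltW eps0) (ltW eps0) eps3 eps3; rewrite expr2; lra.
(* The excess of [7 / 32] over [3 / 16] is worth a factor 2, since [n * eps ^ 2 > 24]; this pays for
   the discarded configurations. *)
pose b := 7 / 32 * (n%:R * eps ^+ 2).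
have massG : expR (- b) < conf_mass G.
  have L10 : (10 <= L)%N by exact: leq_trans L94.
  have bad := @conf_mass_small_gap R L n L10.
  have split_mass : conf_mass (returns L A a) <= conf_mass G +
      conf_mass [set x : {ffun 'I_n -> cell L} |
        (\sum_(i < n) cell_gap (x i) ^+ 2 < 18 / 100 * n%:R :> R)%R]%SET :> R.
    rewrite /conf_mass (big_setID [set x : {ffun 'I_n -> cell L} |
      (\sum_(i < n) cell_gap (x i) ^+ 2 < 18 / 100 * n%:R :> R)%R]%SET) /= addrC lerD2l.
    rewrite big_mkcond [X in _ <= X]big_mkcond /=; apply: ler_sum => x _.
    rewrite finset.in_setI; case: (x \in returns L A a) => //=.
    by case: ifP => // _; exact: conf_prob_ge0.
  have half : 2 * expR (- b) <= expR (- (3 / 16 * (n%:R * eps ^+ 2))).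
    rewrite (_ : - (3 / 16 * _) = - b + (n%:R * eps ^+ 2) / 32); last by rewrite /b; field.
    rewrite expRD mulrC ler_pM2l ?expR_gt0 //.
    have h34 : 3 / 4 <= (n%:R * eps ^+ 2) / 32 by lra.
    have := @expR_ge_quadratic R (3 / 4) _; rewrite -ler_expR in h34.
    by move=> H; apply: le_trans h34; apply: le_trans (H _); lra.
  have bad2 : expR (- (n%:R / 40)) <= expR (- b).
    rewrite ler_expR lerN2 /b.
    have : n%:R * eps ^+ 2 <= n%:R * (1 / 9) by rewrite ler_wpM2l.
    have : 0 <= n%:R :> R by [].
    lra.
  lra.
(* The share [p] to exchange is chosen such that [1 - 2 * p = cos alpha]. *)
have cos01 : 0 <= (1 - cos alpha) / 2 <= 1.
  by have := cos_geN1 alpha; have := cos_le1 alpha; move=> h1 h2; apply/andP; split; lra.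
have [x [x' [f [xG x'G ff fcos fdist]]]] := flipped_pair L1 cos01 massG.
have norm_ge t : t \in G -> 18 / 100 * n%:R <= dotv (gap_vector t) (gap_vector t) :> R.
  rewrite finset.in_setD finset.in_set -leNgt => /andP[h _]; apply: le_trans h _.
  by rewrite le_eqVlt; apply/orP; left; apply/eqP/eq_bigr => i _; rewrite !mxE expr2.
have ret t : t \in G -> t \in returns L A a by rewrite finset.in_setD => /andP[].
have /fattenP[f0 f0F fa] := aA.
move: f0F; rewrite finset.in_set => /asboolP[y Ey cy].
have L0 : (0 < L)%N by exact: ltnW.
have cya : exists2 g : 'I_n -> nat, cube z q (fun i => g i) y &
    forall i, (g i <= a i < g i + m)%N by exists (fun i => nat_of_ord (f0 i)).
have [e1 Ee1 he1] := returns_point q_gt0 L0 cya (ret _ xG).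
have [e2 Ee2 he2] := returns_point q_gt0 L0 cya (ret _ x'G).
pose w1 := (2 * q%:R / L%:R) *: (e1 - y); pose w2 := (2 * q%:R / L%:R) *: (e2 - y).
have m0 : 0 < m%:R :> R by rewrite ltr0n.
have LE : L%:R = (M%:R - 1) * m%:R :> R by rewrite natrM natrB // ltnW.
have M10 : 0 < M%:R - 1 :> R by lra.
have grid : 2 * m%:R / L%:R <= 8 / 125 * eps.
  rewrite LE -mulf_div divff ?gt_eqF // mulr1 ler_pdivrMr //.
  by move: M31; clear; lra.
have nearby (w v : 'rV[R]_n) : (forall i, `|(w - v) ord0 i| <= 2 * m%:R / L%:R) ->
    dotv (w - v) (w - v) <= (8 / 125 * eps) ^+ 2 * n%:R.
  move=> h; have e0 : 0 <= 8 / 125 * eps by rewrite mulr_ge0 // ltW.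
  have : enorm (w - v) <= Num.sqrt n%:R * (8 / 125 * eps).
    by apply: enorm_le => // i; apply: le_trans (h i) grid.
  have sn : 0 <= Num.sqrt (n%:R : R) * (8 / 125 * eps) by rewrite mulr_ge0 // sqrtr_ge0.
  rewrite -ler_sqr ?nnegrE ?enorm_ge0 //.
  by rewrite enorm_sqr exprMn sqr_sqrtr // mulrC.
have fcos' : `|dotv f (gap_vector x') - cos alpha * dotv (gap_vector x') (gap_vector x')| <= 4.
  by move: fcos; rewrite (_ : 1 - 2 * ((1 - cos alpha) / 2) = cos alpha) //; field.
(* [4 * b] is [7 / 8] of [n * eps ^ 2], and the rounding term at most [1 / 40] of it. *)
have fdist' : dotv (gap_vector x - f) (gap_vector x - f) <= 9 / 10 * (n%:R * eps ^+ 2).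
  apply: le_trans fdist _.
  have Leps : 31 <= L%:R * eps.
    have m1 : 1 <= m%:R :> R by rewrite ler1n.
    have : (M%:R - 1) * eps * 1 <= (M%:R - 1) * eps * m%:R.
      by rewrite ler_wpM2l // mulr_ge0 // ltW.
    by rewrite LE mulr1 mulrAC; move: M31; clear; lra.
  have Leps2 : 640 <= (L%:R * eps) ^+ 2.
    by have := ler_pM (ler0n R 31) (ler0n R 31) Leps Leps; rewrite expr2; lra.
  have L2 : 0 < L%:R ^+ 2 :> R by rewrite exprn_gt0 // ltr0n.
  have : 16 * n%:R / L%:R ^+ 2 <= n%:R * eps ^+ 2 / 40.
    rewrite ler_pdivrMr //; have := ler_wpM2l (ler0n R n) Leps2.
    by rewrite exprMn; clear; lra.
  by rewrite /b; clear; lra.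
have [w10 w20] := angle_perturbation eps0 eps3 neps lo up (norm_ge _ xG) (norm_ge _ x'G)
  ff fcos' fdist' (nearby w1 _ he1) (nearby w2 _ he2).
have k0 : 0 < 2 * q%:R / L%:R :> R by rewrite divr_gt0 ?mulr_gt0 ?ltr0n.
rewrite vangleZ // -angleE => close.
have pieps : 31 / 10 * eps <= pi * eps by rewrite ler_wpM2r ?ltW // pi_gt.
have {}close : alpha - pi * eps < angle e1 y e2 < alpha + pi * eps.
  by move: close; rewrite ler_norml => /andP[h1 h2]; apply/andP; split; lra.
have n1 : e1 != y by apply: contra_neq w10 => e; rewrite /w1 e subrr scaler0.
have n2 : e2 != y by apply: contra_neq w20 => e; rewrite /w2 e subrr scaler0.
exists e1, y, e2; split; first by split.
split => //; split; rewrite // 1?eq_sym //.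
(* Equal end points would give the angle 0, which is not above [alpha - pi * eps]. *)
apply: contraTneq close => e; rewrite negb_and -!leNgt angleE e /vangle -/(vcos _ _).
by rewrite vcosxx ?subr_eq0 // acos1 subr_ge0 lo.
Qed.

End final.

(** * The three ranges of the target angle, and the theorem *)

Lemma cos_pi_div3 (R : realType) : cos (pi / 3) = 1 / 2 :> R.
Proof.
have pi0 := @pi_gt0 R; set c := cos (pi / 3).
have c0 : 0 < c by rewrite cos_gt0_pihalf //; apply/andP; split; lra.
have : cos (pi - pi / 3) = cos ((pi / 3) *+ 2) :> R by congr cos; field.
rewrite cosB cospi sinpi mul0r addr0 mulN1r cos_mulr2n -/c -mulr_natr expr2 => e.
have : (c - 1 / 2) * (c + 1) = 0 by lra.
by move/eqP; rewrite mulf_eq0 => /orP[/eqP|/eqP]; lra.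
Qed.

Lemma not_wide_angle (R : realType) (n : nat) (x y z : 'rV[R]_n) : x != y -> z != y ->
  ~ wide_angle x y z -> pi / 3 <= angle x y z <= pi - pi / 3.
Proof.
move=> xy zy; rewrite -subr_eq0 in xy; rewrite -subr_eq0 in zy.
move=> /negP; rewrite -leNgt ler_norml => /andP[h1 h2].
have pi0 := @pi_gt0 R.
rewrite angleE ge_vangle ?le_vangle // ?cosB ?cospi ?sinpi ?cos_pi_div3;
  by apply/andP; split; lra.
Qed.

Lemma rate_lt (R : realType) (eps : R) : 0 < eps -> eps <= 1 ->
  0 < eps ^+ 2 / (8 * ln (8 / eps)) < eps / 4.
Proof.
move=> eps0 eps1; have e8 : 8 <= 8 / eps by rewrite ler_pdivlMr //; lra.
have l2 : 1 / 2 < ln (8 / eps).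
  have h := @expR_ge1Dx R (- (1 / 2)); have e := @expRxMexpNx_1 R (1 / 2).
  have h' := ler_wpM2l (@expR_ge0 R (1 / 2)) h.
  rewrite -[X in X < _]expRK ltr_ln ?posrE ?expR_gt0 ?divr_gt0 //; lra.
have l0 : 0 < 8 * ln (8 / eps) by lra.
rewrite divr_gt0 ?exprn_gt0 //= ltr_pdivrMr // expr2 -mulrA ltr_pM2l //; lra.
Qed.

Section window.
Context {R : realType} {n : nat}.

Lemma angle_window (E : set 'rV[R]_n) (eps alpha : R) (c s : nat) :
  0 < eps <= 1 -> 0 <= alpha <= pi -> (c + s)%N = n ->
  c%:R < eps ^+ 2 / (8 * ln (8 / eps)) * n%:R -> ((s%:R : R)%:E < hausdorff_dim E)%E ->
  exists x y z, [/\ E x, E y & E z] /\ [/\ x != y, y != z & x != z] /\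
    alpha - pi * eps < angle x y z < alpha + pi * eps.
Proof.
move=> /andP[eps0 eps1] /andP[alpha0 alphapi] cs ceps dimE.
have pi0 := @pi_gt0 R.
(* Codimension 0 is excluded because the dimension is at most [n]. *)
have c0 : (0 < c)%N.
  rewrite lt0n; apply/eqP => c0; move: dimE (hausdorff_dim_le_ambient E).
  by rewrite -[X in _ -> (_ <= (X%:R)%:E)%E -> _]cs c0 add0n ltNge => /negP.
have pieps : 0 < pi * eps <= pi.
  by rewrite mulr_gt0 //= -[X in _ <= X]mulr1 ler_pM2l.
have Einf : infinite_set E.
  by apply: infinite_of_dim; apply: le_lt_trans dimE; rewrite lee_fin.
have [small large] := extreme_angles Einf pieps.
have angle_itv (x y z : 'rV[R]_n) : x != y -> y != z -> 0 <= angle x y z <= pi.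
  by move=> xy yz; rewrite angleE vangle_itv // subr_eq0 // eq_sym.
have [lo|lo] := ltrP alpha (pi * eps).
  have [x [y [z [Exyz [[xy yz xz] xyz]]]]] := small.
  exists x, y, z; split => //; split => //.
  by have /andP[h _] := angle_itv x y z xy yz; apply/andP; split; lra.
have [up|up] := ltrP (pi - pi * eps) alpha.
  have [x [y [z [Exyz [[xy yz xz] xyz]]]]] := large.
  exists x, y, z; split => //; split => //.
  by have /andP[_ h] := angle_itv x y z xy yz; apply/andP; split; lra.
(* Now [pi * eps <= alpha <= pi - pi * eps]. *)
have eps2 : eps <= 1 / 2.
  by rewrite -(ler_pM2l pi0); lra.
have [eps3|eps3] := lerP eps (1 / 3); first exact: dense_box_angle cs c0 ceps dimE.
have s2 : 2 <= s%:R :> R.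
  have /andP[_ rate] := rate_lt eps0 eps1.
  have c1 : 1 <= c%:R :> R by rewrite ler1n.
  have sn : c%:R + s%:R = n%:R :> R by rewrite -natrD cs.
  have : eps ^+ 2 / (8 * ln (8 / eps)) * n%:R <= 1 / 8 * n%:R.
    by rewrite ler_wpM2r //; lra.
  lra.
apply: contrapT => none.
suff /(lt_le_trans dimE) : (hausdorff_dim E <= 2%:E)%E by rewrite lte_fin; lra.
(* As [eps > 1 / 3], the window contains the interval from [pi / 3] to [2 pi / 3], so any angle in
   that interval is a solution. *)
apply: wide_dim_le => x y z Ex Ey Ez xy yz xz; apply: contrapT => wide.
apply: none; exists x, y, z; split => //; split => //.
have zy : z != y by rewrite eq_sym.
have := not_wide_angle xy zy wide.
have : pi * (1 / 3) < pi * eps by rewrite ltr_pM2l.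
have : pi * eps <= pi * (1 / 2) by rewrite ler_pM2l.
by move=> h1 h2 /andP[h3 h4]; apply/andP; split; lra.
Qed.

End window.

Unset Implicit Arguments.

Theorem theorem7p1 (R : realType) (n : nat) (n_gt0 : (0 < n)%N)
    (eps : R) (eps_gt0 : 0 < eps) (eps_le1 : eps <= 1)
    (E : set 'rV[R]_n) (borelE : borel_set E)
    (dimE : (((Num.floor ((1 - eps ^+ 2 / (8 * ln (8 / eps))) * n%:R))%:~R
               + 1 : R)%:E < hausdorff_dim E)%E)
    (alpha : R) (alpha_ge0 : 0 <= alpha) (alpha_lepi : alpha <= pi) :
  exists x y z : 'rV[R]_n,
    [/\ E x, E y & E z] /\
    [/\ x != y, y != z & x != z] /\
    alpha - pi * eps < angle x y z < alpha + pi * eps.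
Proof.
have /andP[rate0 rate1] := rate_lt eps_gt0 eps_le1.
set rate := eps ^+ 2 / _ in rate0 rate1 dimE *.
have n0 : 0 < n%:R :> R by rewrite ltr0n.
have f0 : 0 <= Num.floor ((1 - rate) * n%:R).
  by rewrite floor_ge0 mulr_ge0 //; lra.
have /andP[fl fu] := floor_itv ((1 - rate) * n%:R).
move: fl fu dimE; case: (Num.floor _) f0 => // f _.
rewrite intrD -!pmulrn natr1 => fl fu dimE.
have fn : (f < n)%N.
  rewrite -(ltr_nat R); apply: (le_lt_trans fl).
  by rewrite mulrBl mul1r ltrBlDr ltrDl mulr_gt0.
(* The integer dimension bound is [f.+1], where [f] is the floor; [(1 - rate) * n < f + 1] bounds
   the codimension by [rate * n]. *)
apply: (@angle_window R n E eps alpha (n - f.+1) f.+1) => //; first by apply/andP.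
- by apply/andP.
- by rewrite subnK.
- by rewrite natrB // -/rate; rewrite -natr1 in fu *; lra.
Qed.
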